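(* Let $0<\delta_0<1$ be fixed. There exist $\lambda_0>0$ and a function $s:(0,\lambda_0)\to(0,1]$ with $s(\lambda)\to1$ as $\lambda\to0$ such that for every $\lambda\in(0,\lambda_0)$ the integrated density of states $\mathcal N=\mathcal N_\lambda$ of the Anderson–Bernoulli model with disorder $\lambda$ is $s(\lambda)$-Hölder regular on $\{E\in\mathbb R:\delta_0<|E|<2-\delta_0\}$; that is, there is a constant $C=C(\lambda)$ with $$|\mathcal N(E)-\mathcal N(E')|\le C|E-E'|^{s(\lambda)}$$ for all $E,E'$ with $\delta_0<|E|<2-\delta_0$ and $\delta_0<|E'|<2-\delta_0$.
   Context: Anderson–Bernoulli model: $H_\lambda=\Delta+\lambda V$ on $\ell^2(\mathbb Z)$, where $\Delta$ is the lattice Laplacian $(\Delta u)_n=u_{n-1}+u_{n+1}$ and $(V u)_n=\varepsilon_n u_n$, with $(\varepsilon_n)_{n\in\mathbb Z}$ independent random variables taking the values $1$ and $-1$ with probability $\tfrac12$ each; $\lambda>0$ is the disorder. The integrated density of states (IDS) is $$\mathcal N(E)=\lim_{n\to\infty}\frac1n\#\{\text{eigenvalues}\le E\text{ of the restriction of }H_\lambda\text{ to }[1,n]\},$$ eigenvalues counted with multiplicity, where the restriction is the $n\times n$ matrix obtained by Dirichlet truncation; the limit exists almost surely and is non-random. *)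

(* Defs.v *)
From HB Require Import structures.
From mathcomp Require Import all_boot all_order all_algebra.
From mathcomp Require Import all_classical all_reals all_analysis.

Set Implicit Arguments.
Unset Strict Implicit.
Unset Printing Implicit Defensive.

Import Order.TTheory GRing.Theory Num.Theory.
Import numFieldNormedType.Exports.

Local Open Scope classical_set_scope.
Local Open Scope ring_scope.

Definition mutually_independent (R : realType) (d : measure_display)
    (T : measurableType d) (P : probability T R) (I : choiceType)
    (X : I -> {RV P >-> R}) : Prop :=
  forall (J : seq I) (B : I -> set R), uniq J ->
    (forall i, measurable (B i)) ->
    P (\bigcap_(i in [set` J]) (X i @^-1` B i)) =
    (\prod_(i <- J) P (X i @^-1` B i))%E.

Definition rademacher (R : realType) (d : measure_display)
    (T : measurableType d) (P : probability T R) (X : {RV P >-> R}) : Prop :=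
  P (X @^-1` [set 1]) = (2^-1)%:E /\ P (X @^-1` [set -1]) = (2^-1)%:E.

(* The formula makes sense for every sequence on Z; on square-summable ones it
   is the bounded self-adjoint operator H_lambda. *)
Definition anderson_op (R : realType) (lambda : R) (v : int -> R)
    (u : int -> R) : int -> R :=
  fun m => u (m - 1) + u (m + 1) + lambda * (v m * u m).

Definition delta_seq (R : realType) (k : int) : int -> R :=
  fun m => (m == k)%:R.

(* Indices i, j < n stand for the sites i + 1, j + 1 of [1, n]. *)
Definition dirichlet_restriction (R : realType)
    (H : (int -> R) -> int -> R) (n : nat) : 'M[R]_n :=
  \matrix_(i < n, j < n) H (delta_seq R j.+1%:Z) i.+1%:Z.

(* A finite-support sum: the support consists of roots of char_poly A. *)
Definition num_eigenvalues_le (R : realType) (n : nat) (A : 'M[R]_n) (E : R)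
    : nat :=
  \sum_(x \in [set x : R | eigenvalue A x /\ x <= E]) mup x (char_poly A).

(* The limit determines N E uniquely. The almost sure set may depend on E. *)
Definition is_IDS (R : realType) (d : measure_display)
    (T : measurableType d) (P : probability T R)
    (eps : int -> {RV P >-> R}) (lambda : R) (N : R -> R) : Prop :=
  forall E : R, \forall w \ae P,
    (num_eigenvalues_le
       (dirichlet_restriction (anderson_op lambda (fun m => eps m w)) n)
       E)%:R / n%:R @[n --> \oo] --> N E.

(* Main.v *)
(* Let [v_k(E)] be the vector of two consecutive values of the solution of
   [H u = E u] with Dirichlet condition at one end.  At [lambda = 0] the transfer
   matrix is a rotation for the form [Q_E (x, y) = x^2 - E x y + y^2], and
   second-order perturbation theory gives, for [0 < s < 1],
   [E |g v|^(-2s) = |v|^(-2s) (1 - c s (1 - s) lambda^2 + O(lambda^3))] once [Q_E^(-s)]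
   is multiplied by [1 + lambda^2 b], [b] being the solution of a cohomological
   equation over the rotation which exists because [E] is away from [0, 2, -2].
   Hence this weight is contracted in mean as soon as [1 - s >= K lambda].  For two
   energies the Wronskian of [v_k(E)] and [v_k(E')] changes by at most
   [|E - E'| |v_k(E)| |v_k(E')|] per step, so by Cauchy-Schwarz the mean of the
   [s]-th power of the sine of their angle stays [O(|E - E'|^s)].  By Sturm
   oscillation, the number of eigenvalues between [E] and [E'] is at most one plus
   four times the number of steps at which this angle is not small, and the latter
   is [O(n |E - E'|^s)] in mean. *)

Require Import Defs.
From HB Require Import structures.
From mathcomp Require Import all_boot all_order all_algebra.
From mathcomp Require Import all_classical all_reals all_analysis.
From mathcomp Require Import measurable_realfun ring lra.
From mathcomp Require Import polyorder polyrcf qe_rcf_th.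

Set Implicit Arguments.
Unset Strict Implicit.
Unset Printing Implicit Defensive.

Import Order.TTheory GRing.Theory Num.Theory.
Import numFieldNormedType.Exports.

Local Open Scope classical_set_scope.
Local Open Scope ring_scope.

(** * Second-order drift of the corrected norm *)

Section Drift.
Variable R : realFieldType.

(* A direction [(x, y)] enters through [A = x^2 / Q] and [D = x (E x / 2 - y) / Q],
   where [Q = x^2 - E x y + y^2]; [sin2 E] is the squared sine of the rotation angle,
   [freeA], [freeD] describe the rotation at zero disorder, and [corrA], [corrB] solve
   its cohomological equations for [A] and [4 D^2] (the first and second harmonics). *)
Definition sin2 (E : R) : R := 1 - E ^+ 2 / 4.
Definition corrA (E A D : R) : R :=
  - (E * D + 2 * sin2 E * A - 1) / (4 * sin2 E).
Definition corrB (E A D : R) : R :=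
  (4 * D * (2 * sin2 E * A - 1) * (1 - 2 * sin2 E) / E
   + 1 - 8 * sin2 E * D ^+ 2) / (4 * sin2 E).
Definition freeA (E A D : R) : R := 1 + E * D + (1 - 2 * sin2 E) * A.
Definition freeD (E A D : R) : R := E / 2 * freeA E A D - (E / 2 * A + D).

(** The constant [(2 * sin2 E)^-1] is the mean of [A] over the free rotation; only the first
    harmonic is left to be solved for. *)
Lemma corrA_cobound (E A D : R) : sin2 E != 0 ->
  corrA E (freeA E A D) (freeD E A D) - corrA E A D = A - (2 * sin2 E)^-1.
Proof.
move=> q0; have E2 : E ^+ 2 = 4 - 4 * sin2 E by rewrite /sin2; field.
rewrite /corrA /freeD /freeA; move: (sin2 E) q0 E2 => q q0 E2.
by field: E2.
Qed.

(** On the ellipse [D ^+ 2 = A - sin2 E * A ^+ 2] the mean of [4 * D ^+ 2] equals that of [A], so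
    the second-order drift vanishes at [sig = 0]. The second harmonic is resonant when the rotation
    angle is a right angle, that is at [E = 0], whence the division by [E]. *)
Lemma corrB_cobound (E A D : R) : sin2 E != 0 -> E != 0 ->
  D ^+ 2 = A - sin2 E * A ^+ 2 ->
  corrB E (freeA E A D) (freeD E A D) - corrB E A D
  = 4 * D ^+ 2 - (2 * sin2 E)^-1.
Proof.
move=> q0 E0; have E2 : E ^+ 2 = 4 - 4 * sin2 E by rewrite /sin2; field.
rewrite /corrB /freeD /freeA; move: (sin2 E) q0 E2 => q q0 E2 HD.
by field: E2 HD; rewrite ?q0 ?E0.
Qed.

(** The coefficients are those of [t] and [t ^+ 2] in [frac_expansion], so that this corrector
    removes the oscillating part of the whole second-order term. *)
Definition corr (sig E A D : R) : R :=
  (1 - sig) * corrA E A D - (1 - 9 / 8 * sig) * corrB E A D.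

Lemma normM_le (x y a b : R) : `|x| <= a -> `|y| <= b -> `|x * y| <= a * b.
Proof. by move=> xa yb; rewrite normrM ler_pM. Qed.

Lemma normD_le (x y a b : R) : `|x| <= a -> `|y| <= b -> `|x + y| <= a + b.
Proof. by move=> xa yb; rewrite (le_trans (ler_normD _ _)) ?lerD. Qed.

Lemma normB_le (x y a b : R) : `|x| <= a -> `|y| <= b -> `|x - y| <= a + b.
Proof. by move=> xa yb; rewrite (le_trans (ler_normB _ _)) ?lerD. Qed.

(** * Corrector bounds, uniform in a bound [M] of the inverses of [E] and [sin2 E] *)

Section Bounds.
Variables (M E : R).
Hypotheses (M1 : 1 <= M) (E2 : `|E| <= 2) (EM : `|E^-1| <= M).
Hypotheses (q0 : 0 < sin2 E) (qM : (sin2 E)^-1 <= M).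

Let M0 : 0 <= M. Proof. exact: le_trans M1. Qed.
Let q1 : sin2 E <= 1.
Proof. by rewrite /sin2; have := sqr_ge0 E; lra. Qed.

Let nq : `|sin2 E| <= 1. Proof. by rewrite gtr0_norm. Qed.
Let n4q : `|(4 * sin2 E)^-1| <= M / 4.
Proof.
rewrite invfM normrM [`|4^-1|]gtr0_norm ?invr_gt0 //.
by rewrite [`|(sin2 E)^-1|]gtr0_norm ?invr_gt0// mulrC ler_pM2r ?invr_gt0.
Qed.
Let n12q : `|1 - 2 * sin2 E| <= 1.
Proof. by rewrite ler_norml; move: q0 q1; lra. Qed.

Lemma corrA_bound (A D : R) : `|A| <= M -> `|D| <= M ->
  `|corrA E A D| <= 5 / 4 * M ^+ 2.
Proof.
move=> hA hD; rewrite /corrA normrM normrN.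
have h : `|E * D + 2 * sin2 E * A - 1| <= 2 * M + 2 * 1 * M + 1.
  apply: normB_le; last by rewrite normr1.
  apply: normD_le; first exact: normM_le.
  by do 2?apply: normM_le => //; rewrite normr_nat.
apply: le_trans (ler_pM _ _ h n4q) _ => //.
by move: M1; nra.
Qed.

Lemma corrB_bound (A D : R) : `|A| <= M -> `|D| <= M ->
  `|corrB E A D| <= 21 / 4 * M ^+ 4.
Proof.
move=> hA hD; rewrite /corrB normrM.
have h : `|4 * D * (2 * sin2 E * A - 1) * (1 - 2 * sin2 E) / E
   + 1 - 8 * sin2 E * D ^+ 2| <= 4 * M * (2 * 1 * M + 1) * 1 * M + 1 + 8 * 1 * M ^+ 2.
  apply: normB_le; last first.
    apply: normM_le; last by rewrite normrX lerXn2r ?nnegrE.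
    by apply: normM_le => //; rewrite normr_nat.
  apply: normD_le; last by rewrite normr1.
  apply: normM_le => //; apply: normM_le => //; apply: normM_le.
    by apply: normM_le => //; rewrite normr_nat.
  apply: normB_le; last by rewrite normr1.
  by do 2?apply: normM_le => //; rewrite normr_nat.
apply: le_trans (ler_pM _ _ h n4q) _ => //.
have M2 : 1 <= M ^+ 2 by rewrite exprn_ege1.
have M3 : M <= M ^+ 3 by rewrite -[leLHS]expr1 ler_weXn2l.
have M4 : M ^+ 2 <= M ^+ 4 by rewrite ler_weXn2l.
have M5 : M ^+ 3 <= M ^+ 4 by rewrite ler_weXn2l.
have -> : (4 * M * (2 * 1 * M + 1) * 1 * M + 1 + 8 * 1 * M ^+ 2) * (M / 4)
  = 2 * M ^+ 4 + M ^+ 3 + M / 4 + 2 * M ^+ 3 by field.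
by lra.
Qed.

Lemma corr_bound (sig A D : R) : 0 <= sig <= 1 / 2 -> `|A| <= M -> `|D| <= M ->
  `|corr sig E A D| <= 7 * M ^+ 4.
Proof.
move=> /andP[s0 s1] hA hD.
have M4 : M ^+ 2 <= M ^+ 4 by rewrite ler_weXn2l.
have nA := corrA_bound hA hD; have nB := corrB_bound hA hD.
rewrite /corr; apply: (@le_trans _ _ (1 * (5 / 4 * M ^+ 2) + 1 * (21 / 4 * M ^+ 4))).
  by apply: normB_le; apply: normM_le => //; rewrite ler_norml; lra.
by have : 0 <= M ^+ 4 by [rewrite exprn_ge0]; lra.
Qed.

(** The two displacement bounds are those that [drift_step] finds between a disordered step and the
    free one. As the corrector enters with the factor [l ^+ 2], the resulting error is cubic. *)
Lemma corr_lip (sig l A D A' D' : R) : 0 <= sig <= 1 / 2 -> 0 <= l ->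
  `|A| <= M -> `|D| <= M -> `|A'| <= M -> `|D'| <= M ->
  `|A' - A| <= 16 * M ^+ 2 * l -> `|D' - D| <= 18 * M ^+ 2 * l ->
  `|corr sig E A' D' - corr sig E A D| <= 18 * 10 * M ^+ 5 * l.
Proof.
move=> /andP[s0 s1] l0 hA hD hA' hD' dA dD.
have -> : corr sig E A' D' - corr sig E A D =
  (1 - sig) * (- (E * (D' - D) + 2 * sin2 E * (A' - A)) * (4 * sin2 E)^-1)
  - (1 - 9 / 8 * sig) *
    ((4 * (((D' - D) * (2 * sin2 E * A' - 1) + D * (2 * sin2 E * (A' - A))))
        * (1 - 2 * sin2 E) * E^-1
      - 8 * sin2 E * ((D' - D) * (D' + D))) * (4 * sin2 E)^-1).
  by rewrite /corr /corrA /corrB; ring.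
have n2 (k : nat) : `|k%:R : R| <= k%:R by rewrite normr_nat.
apply: (@le_trans _ _ (1 * ((2 * (18 * M ^+ 2 * l) + 2 * 1 * (16 * M ^+ 2 * l))
   * (M / 4)) + 1 * ((4 * ((18 * M ^+ 2 * l) * (2 * 1 * M + 1) +
      M * (2 * 1 * (16 * M ^+ 2 * l))) * 1 * M
      + 8 * 1 * ((18 * M ^+ 2 * l) * (M + M))) * (M / 4)))).
  apply: normB_le; (apply: normM_le; first by rewrite ler_norml; lra).
    apply: normM_le => //; rewrite normrN; apply: normD_le; first exact: normM_le.
    by do 2?apply: normM_le => //.
  apply: normM_le => //; apply: normB_le; last first.
    apply: normM_le; first exact: normM_le.
    by apply: normM_le => //; apply: normD_le.
  do 3![apply: normM_le => //]; apply: normD_le.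
    apply: normM_le => //; apply: normB_le; last by rewrite normr1.
    by do 2?apply: normM_le => //.
  by do 3?apply: normM_le => //.
have -> : (1 * ((2 * (18 * M ^+ 2 * l) + 2 * 1 * (16 * M ^+ 2 * l))
   * (M / 4)) + 1 * ((4 * ((18 * M ^+ 2 * l) * (2 * 1 * M + 1) +
      M * (2 * 1 * (16 * M ^+ 2 * l))) * 1 * M
      + 8 * 1 * ((18 * M ^+ 2 * l) * (M + M))) * (M / 4)))
  = (17 * M ^+ 3 + 68 * M ^+ 5 + 18 * M ^+ 4 + 72 * M ^+ 4) * l by field.
apply: ler_wpM2r => //.
have M3 : M ^+ 3 <= M ^+ 5 by rewrite ler_weXn2l.
have M4 : M ^+ 4 <= M ^+ 5 by rewrite ler_weXn2l.
have M5 : 0 <= M ^+ 5 by exact: exprn_ge0.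
by lra.
Qed.


(* A second-order upper bound of [(1 + t) ^ (sig - 1)], see [powR_le_frac]; being
   lossy only by a fraction of [sig t^2], it keeps the gain in [drift_avg]. *)
Definition frac (sig t : R) : R := (1 + sig * t - sig / 8 * t ^+ 2) / (1 + t).

Lemma frac_expansion (sig t : R) : 1 + t != 0 -> frac sig t =
  1 - (1 - sig) * t + (1 - 9 / 8 * sig) * t ^+ 2
    - (1 - 9 / 8 * sig) * t ^+ 3 / (1 + t).
Proof. by move=> t0; rewrite /frac; field. Qed.

(** Expansion for one value [e] of the spin: [1 + t] is the factor gained by [Q], and [(A1, D1)] is
    the new direction. The first-order term is kept exactly because it is odd in [e] and cancels in
    the mean; everything beyond second order goes into the cubic error. *)
Lemma drift_step (l sig e A D A1 D1 t : R) :
  0 < l -> 6 * M * l <= 1 -> 0 <= sig <= 1 / 2 -> e ^+ 2 = 1 ->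
  t = l ^+ 2 * A - 2 * l * e * D ->
  `|A| <= M -> `|D| <= M -> `|A1| <= M -> `|D1| <= M ->
  `|freeA E A D| <= M -> `|freeD E A D| <= M ->
  (1 + t) * A1 = freeA E A D - 2 * l * e * (E / 2 * A + D) + l ^+ 2 * A ->
  (1 + t) * D1 = E / 2 * ((1 + t) * A1) - (E / 2 * A + D) + l * e * A ->
  frac sig t * (1 + l ^+ 2 * corr sig E A1 D1) <=
  1 + (1 - sig) * 2 * l * e * D + l ^+ 2 *
    (- (1 - sig) * A + 4 * (1 - 9 / 8 * sig) * D ^+ 2
     + corr sig E (freeA E A D) (freeD E A D)) + 32 * 10 * M ^+ 5 * l ^+ 3.
Proof.
move=> l0 lM ss e2 tE hA hD hA1 hD1 hA0 hD0 eA1 eD1.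
have /andP[s0 s1] := ss.
have c1 : `|1 - sig| <= 1 by rewrite ler_norml; lra.
have c2 : `|1 - 9 / 8 * sig| <= 1 by rewrite ler_norml; lra.
have c3 : `|sig / 8| <= 1 by rewrite ger0_norm; lra.
have ne : `|e| <= 1.
  have /eqP : (e - 1) * (e + 1) = 0 by rewrite -subr_sqr e2 expr1n subrr.
  by rewrite mulf_eq0 subr_eq0 addr_eq0 => /orP[]/eqP ->; rewrite ?normrN normr1.
have l1 : l <= 1.
  have : 1 * l <= M * l by apply: ler_wpM2r => //; exact: ltW.
  by lra.
have nl : `|l| <= l by rewrite gtr0_norm.
have n2 (k : nat) : `|k%:R : R| <= k%:R by rewrite normr_nat.
have nl2 : `|l ^+ 2| <= l by rewrite normrX gtr0_norm // expr2; move: l0 l1; nra.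
have nt : `|t| <= 3 * M * l.
  rewrite tE; apply: (@le_trans _ _ (l * M + 2 * l * 1 * M)); last by lra.
  by apply: normB_le; do 3?apply: normM_le.
have nt2 : `|t| <= 1 / 2 by lra.
have t1 : 1 / 2 <= 1 + t by move: nt2; rewrite ler_norml => /andP[]; lra.
have t0 : 0 < 1 + t by lra.
have t10 : 1 + t != 0 by rewrite gt_eqF.
have it : `|(1 + t)^-1| <= 2.
  by rewrite gtr0_norm ?invr_gt0 // -[leLHS]div1r ler_pdivrMr //; lra.
have dA : `|A1 - freeA E A D| <= 16 * M ^+ 2 * l.
  have -> : A1 - freeA E A D = (l ^+ 2 * A - 2 * l * e * (E / 2 * A + D)
      - t * freeA E A D) / (1 + t).
    by apply: (mulIf t10); rewrite mulfVK // [_ * (1 + t)]mulrC mulrBr eA1; ring.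
  apply: (@le_trans _ _ ((l * M + 2 * l * 1 * (1 * M + M) + (3 * M * l) * M) * 2)).
    apply: normM_le => //; apply: normB_le; last exact: normM_le.
    apply: normB_le; first exact: normM_le.
    apply: normM_le; first by do 3?apply: normM_le.
    apply: normD_le => //; apply: normM_le => //.
    by rewrite normrM [`|2^-1|]gtr0_norm ?invr_gt0 // ler_pdivrMr ?mul1r.
  have MM : M * l <= M ^+ 2 * l.
    by apply: ler_wpM2r; [exact: ltW|rewrite -[leLHS]expr1 ler_weXn2l].
  by rewrite expr2 in MM *; lra.
have dD : `|D1 - freeD E A D| <= 18 * M ^+ 2 * l.
  have -> : D1 - freeD E A D =
     (E / 2 * (l ^+ 2 * A - 2 * l * e * (E / 2 * A + D)) + l * e * A
      - t * freeD E A D) / (1 + t).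
    apply: (mulIf t10); rewrite mulfVK // [_ * (1 + t)]mulrC mulrBr eD1 eA1.
    by rewrite /freeD; ring.
  have nE : `|E / 2| <= 1.
    by rewrite normrM [`|2^-1|]gtr0_norm ?invr_gt0 // ler_pdivrMr ?mul1r.
  apply: (@le_trans _ _ ((1 * (l * M + 2 * l * 1 * (1 * M + M)) + l * 1 * M
      + (3 * M * l) * M) * 2)).
    apply: normM_le => //; apply: normB_le; last exact: normM_le.
    apply: normD_le; last by do 3?apply: normM_le.
    apply: normM_le => //; apply: normB_le; first exact: normM_le.
    apply: normM_le; first by do 3?apply: normM_le.
    by apply: normD_le => //; apply: normM_le.
  have MM : M * l <= M ^+ 2 * l.
    by apply: ler_wpM2r; [exact: ltW|rewrite -[leLHS]expr1 ler_weXn2l].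
  by rewrite expr2 in MM *; lra.
have db := corr_lip ss (ltW l0) hA0 hD0 hA1 hD1 dA dD.
have nb := corr_bound ss hA1 hD1.
set b1 := corr sig E A1 D1 in db nb *; set b0 := corr _ _ _ _ in db *.
have M4 : M ^+ 2 <= M ^+ 5 by rewrite ler_weXn2l.
have M5 : M ^+ 3 <= M ^+ 5 by rewrite ler_weXn2l.
have l2 : 0 <= l ^+ 2 by rewrite exprn_ge0 ?ltW.
have l3 : 0 <= l ^+ 3 by rewrite exprn_ge0 ?ltW.
(* Since [e ^+ 2 = 1], the square of [t] is [4 * l ^+ 2 * D ^+ 2] up to a cubic error. *)
have rE : frac sig t <= 1 + (1 - sig) * 2 * l * e * D + l ^+ 2 *
    (- (1 - sig) * A + 4 * (1 - 9 / 8 * sig) * D ^+ 2) + 59 * M ^+ 3 * l ^+ 3.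
  rewrite frac_expansion //.
  have h3 : `|(1 - 9 / 8 * sig) * t ^+ 3 / (1 + t)| <= 1 * (3 * M * l) ^+ 3 * 2.
    apply: normM_le => //; apply: normM_le => //.
    by rewrite normrX lerXn2r ?nnegrE //; do 2?apply: mulr_ge0 => //; exact: ltW.
  have h2 : `|(1 - 9 / 8 * sig) * (t ^+ 2 - 4 * l ^+ 2 * D ^+ 2)|
            <= 1 * (l ^+ 3 * (M * M + 4 * 1 * M * M)).
    apply: normM_le => //.
    have -> : t ^+ 2 - 4 * l ^+ 2 * D ^+ 2
              = l ^+ 3 * (l * (A * A) - 4 * e * A * D).
      transitivity (t ^+ 2 - 4 * l ^+ 2 * e ^+ 2 * D ^+ 2); first by rewrite e2; ring.
      by rewrite tE; ring.
    rewrite normrM [`|l ^+ 3|]ger0_norm //; apply: ler_wpM2l => //.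
    apply: normB_le; last by do 3?apply: normM_le.
    by rewrite -[M * M]mul1r; do 2?apply: normM_le => //; rewrite gtr0_norm.
  have e1 : 1 - (1 - sig) * t + (1 - 9 / 8 * sig) * t ^+ 2
     - (1 - 9 / 8 * sig) * t ^+ 3 / (1 + t) =
     1 + (1 - sig) * 2 * l * e * D + l ^+ 2 *
      (- (1 - sig) * A + 4 * (1 - 9 / 8 * sig) * D ^+ 2)
      + (1 - 9 / 8 * sig) * (t ^+ 2 - 4 * l ^+ 2 * D ^+ 2)
      - (1 - 9 / 8 * sig) * t ^+ 3 / (1 + t).
    by rewrite {1}tE; ring.
  rewrite e1; apply: le_trans (lerB (lerD (lexx _) (ler_normlW h2)) _) _.
    by move: h3; rewrite ler_norml => /andP[h3 _]; exact: h3.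
  have : l ^+ 3 * (5 * M ^+ 2) <= l ^+ 3 * (5 * M ^+ 3).
    by apply: ler_wpM2l => //; rewrite ler_pM2l // ler_weXn2l.
  rewrite -[X in _ -> X <= _]addrA => h5; rewrite -[X in _ <= X]addrA [X in X <= _]addrA.
  clear h2 h3 e1 dA dD db nb nt nt2 t1 it tE eA1 eD1.
  by rewrite !exprMn; lra.
have nr : `|frac sig t - 1| <= 9 * M * l.
  have -> : frac sig t - 1 = (- ((1 - sig) * t + sig / 8 * t * t)) * (1 + t)^-1.
    by rewrite /frac; field.
  apply: (@le_trans _ _ ((1 * (3 * M * l) + 1 * (3 * M * l) * (1 / 2)) * 2)); last first.
    by clear rE db nb dA dD tE eA1 eD1 nt nt2 t1 it; lra.
  apply: normM_le => //; rewrite normrN; apply: normD_le; first exact: normM_le.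
  by do 2?apply: normM_le => //.
(* In front of [l ^+ 2], first-order bounds on [b1 - b0] and [frac sig t - 1] suffice. *)
have -> : frac sig t * (1 + l ^+ 2 * b1) =
  frac sig t + l ^+ 2 * (b0 + (b1 - b0) + (frac sig t - 1) * b1) by ring.
have h0 : 0 <= M ^+ 5 * l by apply: mulr_ge0; [exact: exprn_ge0|exact: ltW].
have h1 : (b1 - b0) + (frac sig t - 1) * b1 <= 25 * 10 * M ^+ 5 * l.
  apply: (le_trans (lerD (ler_normlW db) (ler_normlW (normM_le nr nb)))).
  have -> : 9 * M * l * (7 * M ^+ 4) = 63 * M ^+ 5 * l by ring.
  by clear db nb nr rE dA dD tE eA1 eD1 nt nt2 t1 it; lra.
have h2 : l ^+ 2 * (b1 - b0 + (frac sig t - 1) * b1) <= l ^+ 2 * (25 * 10 * M ^+ 5 * l).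
  exact: ler_wpM2l.
have h3 : l ^+ 3 * M ^+ 3 <= l ^+ 3 * M ^+ 5 by apply: ler_wpM2l.
have h4 : 0 <= l ^+ 3 * M ^+ 5 by apply: mulr_ge0 => //; exact: exprn_ge0.
clear h1 db nb nr dA dD tE eA1 eD1 nt nt2 t1 it.
by lra.
Qed.

(** Averaging over [e] removes the odd term, and the corrector replaces the second-order term by its
    mean, which is negative of size [sig]. Taking [sig] to be a large multiple of [M ^+ 5 * l] makes
    this gain beat the cubic errors. *)
Lemma drift_avg (l sig A D : R) (A1 D1 t : R -> R) :
  E != 0 -> 0 < l -> 60 * 10 * 10 * M ^+ 5 * l <= 1 / 2 -> sig = 60 * 10 * 10 * M ^+ 5 * l ->
  `|A| <= M -> `|D| <= M -> D ^+ 2 = A - sin2 E * A ^+ 2 ->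
  `|freeA E A D| <= M -> `|freeD E A D| <= M ->
  (forall e, e ^+ 2 = 1 -> [/\ t e = l ^+ 2 * A - 2 * l * e * D,
    `|A1 e| <= M, `|D1 e| <= M,
    (1 + t e) * A1 e = freeA E A D - 2 * l * e * (E / 2 * A + D) + l ^+ 2 * A &
    (1 + t e) * D1 e = E / 2 * ((1 + t e) * A1 e) - (E / 2 * A + D) + l * e * A]) ->
  (frac sig (t 1) * (1 + l ^+ 2 * corr sig E (A1 1) (D1 1)) +
   frac sig (t (-1)) * (1 + l ^+ 2 * corr sig E (A1 (-1)) (D1 (-1)))) / 2 <=
  (1 - l ^+ 3) * (1 + l ^+ 2 * corr sig E A D).
Proof.
move=> E0 l0 l5 sE hA hD DA hA0 hD0 H.
have M5 : M <= M ^+ 5 by rewrite -[leLHS]expr1 ler_weXn2l.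
have M45 : M ^+ 4 <= M ^+ 5 by rewrite ler_weXn2l.
have M51 : 1 <= M ^+ 5 by rewrite exprn_ege1.
have lM : 6 * M * l <= 1.
  by have : M * l <= M ^+ 5 * l; [apply: ler_wpM2r => //; exact: ltW|lra].
have l1 : l <= 1.
  by have : l <= M ^+ 5 * l; [apply: ler_peMl => //; exact: ltW|lra].
have K0 : 0 <= 60 * 10 * 10 * M ^+ 5 * l.
  have : 0 <= M ^+ 5 * l by apply: mulr_ge0; [exact: exprn_ge0|exact: ltW].
  by lra.
have ss : 0 <= sig <= 1 / 2 by rewrite sE l5 K0.
have m1 : (-1 : R) ^+ 2 = 1 by rewrite sqrrN expr1n.
have [tp Ap Dp eAp eDp] := H 1 (expr1n _ _).
have [tm Am Dm eAm eDm] := H (-1) m1.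
have hp := drift_step l0 lM ss (expr1n _ _) tp hA hD Ap Dp hA0 hD0 eAp eDp.
have hm := drift_step l0 lM ss m1 tm hA hD Am Dm hA0 hD0 eAm eDm.
have bA := corrA_cobound A D (lt0r_neq0 q0).
have bB := corrB_cobound (lt0r_neq0 q0) E0 DA.
have nb := corr_bound ss hA hD.
(* The equal means carry the coefficients [1 - sig] and [1 - 9 / 8 * sig]; their difference leaves
   the gain [sig / 16 * (sin2 E)^-1]. *)
have bE : corr sig E (freeA E A D) (freeD E A D) = corr sig E A D
   + (1 - sig) * A - 4 * (1 - 9 / 8 * sig) * D ^+ 2 - sig / 16 * (sin2 E)^-1.
  rewrite /corr.
  have -> := canRL (subrK _) bA; have -> := canRL (subrK _) bB.
  by rewrite invfM; field; rewrite lt0r_neq0.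
rewrite ler_pdivrMr //; apply: le_trans (lerD hp hm) _; rewrite bE.
clear hp hm tp tm eAp eDp eAm eDm bA bB bE H.
have iq : 1 <= (sin2 E)^-1 by rewrite invf_ge1.
have l2 : 0 < l ^+ 2 by rewrite exprn_gt0.
have l3 : 0 < l ^+ 3 by rewrite exprn_gt0.
set b := corr sig E A D in nb *.
have lb : l ^+ 2 * b <= 1 / 2.
  apply: le_trans (ler_wpM2l (ltW l2) (ler_normlW nb)) _.
  have : l * (l * M ^+ 4) <= 1 * (l * M ^+ 5).
    have M40 : 0 <= M ^+ 4 by exact: exprn_ge0.
    have l0' := ltW l0.
    apply: ler_pM => //; first exact: mulr_ge0.
    exact: ler_wpM2l.
  by rewrite expr2; lra.
have s2 : 2 * l ^+ 2 * (sig / 16) <= 2 * l ^+ 2 * (sig / 16 * (sin2 E)^-1).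
  apply: ler_wpM2l; first by rewrite mulr_ge0 // ltW.
  by rewrite ler_peMr //; move: ss => /andP[]; lra.
have -> : (1 - l ^+ 3) * (1 + l ^+ 2 * b) * 2 =
  2 + 2 * l ^+ 2 * b - 2 * l ^+ 3 * (1 + l ^+ 2 * b) by ring.
have : 2 * l ^+ 3 * (1 + l ^+ 2 * b) <= 3 * l ^+ 3.
  have : 0 <= l ^+ 3 * (1 / 2 - l ^+ 2 * b) by rewrite mulr_ge0 ?subr_ge0 // ltW.
  by lra.
(* The gain [750 * M ^+ 5 * l ^+ 3] covers twice the error [320 * M ^+ 5 * l ^+ 3] and the
   [3 * l ^+ 3] spent on the factor [1 - l ^+ 3]. *)
have sE' : 2 * l ^+ 2 * (sig / 16) = 75 * 10 * M ^+ 5 * l ^+ 3 by rewrite sE; field.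
have : l ^+ 3 <= M ^+ 5 * l ^+ 3 by rewrite ler_peMl // ltW.
by lra.
Qed.

End Bounds.
End Drift.

(** * Inequalities for real powers *)

Lemma powR_bernoulli (R : realType) (w tau : R) : 0 <= tau <= 1 -> -1 <= w ->
  (1 + w) `^ tau <= 1 + tau * w.
Proof.
move=> /andP[]; rewrite le_eqVlt => /predU1P[<- _ _|t0].
  by rewrite powRr0 mul0r addr0.
rewrite le_eqVlt => /predU1P[->|t1] w1; first by rewrite powRr1 ?mul1r //; lra.
(* Young's inequality for the product of [(1 + w) ^ tau] and [1], with exponents [1 / tau] and
   [1 / (1 - tau)]. *)
have h := @conjugate_powR R ((1 + w) `^ tau) 1 tau^-1 (1 - tau)^-1.
have t1' : 0 < 1 - tau by rewrite subr_gt0.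
have := h (powR_ge0 _ _) ler01; rewrite !invr_gt0 !invrK => /(_ t0 t1').
rewrite addrC subrK => /(_ erefl).
rewrite mulr1 powR1 -powRrM mulfV ?gt_eqF // powRr1; last by lra.
by move/le_trans; apply; rewrite mul1r; lra.
Qed.

(** Bernoulli's inequality alone would lose the quadratic term. It is applied with exponent
    [2 * sig <= 1] to the square root of [1 + t], which is at most [1 + t / 2 - t ^+ 2 / 16]. *)
Lemma powR_le_frac (R : realType) (sig t : R) : 0 <= sig <= 1 / 2 -> `|t| <= 1 / 2 ->
  (1 + t) `^ (sig - 1) <= frac sig t.
Proof.
move=> /andP[s0 s1]; rewrite ler_norml => /andP[t0 t1].
have p : 0 < 1 + t by lra.
rewrite powRB; last by rewrite (gt_eqF p) implybT.
rewrite powRr1 ?(ltW p) // /frac ler_pM2r ?invr_gt0 //.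
have -> : sig = 2^-1 * (2 * sig) by field.
rewrite powRrM powR12_sqrt ?(ltW p) //.
have sq : Num.sqrt (1 + t) <= 1 + (t / 2 - t ^+ 2 / 16).
  have h : 0 <= 1 + (t / 2 - t ^+ 2 / 16) by nra.
  rewrite -(ler_pXn2r (n := 2)) ?nnegrE ?sqrtr_ge0 // sqr_sqrtr ?(ltW p) //.
  have : 0 <= t ^+ 2 * (1 / 8 - t / 16) by rewrite mulr_ge0 ?sqr_ge0 //; lra.
  have -> : (1 + (t / 2 - t ^+ 2 / 16)) ^+ 2 =
    1 + t + t ^+ 2 * (1 / 8 - t / 16) + (t ^+ 2) ^+ 2 / 256 by field.
  by have := sqr_ge0 (t ^+ 2); lra.
apply: (@le_trans _ _ ((1 + (t / 2 - t ^+ 2 / 16)) `^ (2 * sig))).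
  apply: ge0_ler_powR => //; rewrite ?nnegrE ?sqrtr_ge0 //; first by lra.
  by apply: le_trans sq; exact: sqrtr_ge0.
apply: le_trans (powR_bernoulli _ _) _; [lra| | ].
  by nra.
by have -> : 2^-1 * (2 * sig) = sig; [field|lra].
Qed.

(** * The Lyapunov function of a single energy *)

Section Lyapunov.
Variable R : realType.

Definition qform (E x y : R) : R := x ^+ 2 - E * x * y + y ^+ 2.
Definition coordA (E x y : R) : R := x ^+ 2 / qform E x y.
Definition coordD (E x y : R) : R := x * (E / 2 * x - y) / qform E x y.
Definition weight (sig l E x y : R) : R :=
  1 + l ^+ 2 * corr sig E (coordA E x y) (coordD E x y).
(** With [s = 1 - sig], this is [Q_E^(-s)] with its second-order correction. *)
Definition lyap (sig l E x y : R) : R :=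
  qform E x y `^ (sig - 1) * weight sig l E x y.

Lemma qformE (E x y : R) : qform E x y = sin2 E * x ^+ 2 + (E / 2 * x - y) ^+ 2.
Proof. by rewrite /qform /sin2; field. Qed.

Lemma qform_gt0 (E x y : R) : 0 < sin2 E -> (x != 0) || (y != 0) -> 0 < qform E x y.
Proof.
move=> q0; rewrite qformE; case: (eqVneq x 0) => [->|x0 _] /=.
  by move=> y0; rewrite expr0n mulr0 add0r mulr0 sub0r sqrrN exprn_even_gt0.
by rewrite ltr_wpDr ?sqr_ge0 // mulr_gt0 // exprn_even_gt0.
Qed.

Lemma coordDE (E x y : R) : 0 < sin2 E -> (x != 0) || (y != 0) ->
  coordD E x y ^+ 2 = coordA E x y - sin2 E * coordA E x y ^+ 2.
Proof.
move=> q0 xy; have := qform_gt0 q0 xy; rewrite /coordD /coordA => Q0.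
have Qn : qform E x y != 0 by rewrite gt_eqF.
apply: (mulIf (expf_neq0 2 Qn)).
have -> : (x * (E / 2 * x - y) / qform E x y) ^+ 2 * qform E x y ^+ 2 =
  (x * (E / 2 * x - y)) ^+ 2 by field.
have -> : (x ^+ 2 / qform E x y - sin2 E * (x ^+ 2 / qform E x y) ^+ 2) *
  qform E x y ^+ 2 = x ^+ 2 * qform E x y - sin2 E * x ^+ 4 by field.
by rewrite qformE; ring.
Qed.

Section Bounds.
Variables (M E : R).
Hypotheses (M1 : 1 <= M) (E0 : E != 0) (E2 : `|E| <= 2) (EM : `|E^-1| <= M).
Hypotheses (q0 : 0 < sin2 E) (qM : (sin2 E)^-1 <= M).

Lemma coordA_bound (x y : R) : (x != 0) || (y != 0) -> 0 <= coordA E x y <= M.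
Proof.
move=> xy; have Q0 := qform_gt0 q0 xy.
rewrite /coordA divr_ge0 ?sqr_ge0 ?(ltW Q0) //= ler_pdivrMr //.
apply: (@le_trans _ _ ((sin2 E)^-1 * qform E x y)); last by rewrite ler_pM2r.
by rewrite qformE mulrDr mulKf ?gt_eqF // lerDl mulr_ge0 ?sqr_ge0 // invr_ge0 ltW.
Qed.

Lemma coordA_norm (x y : R) : (x != 0) || (y != 0) -> `|coordA E x y| <= M.
Proof. by move=> /coordA_bound/andP[a0 aM]; rewrite ger0_norm. Qed.

Lemma coordD_norm (x y : R) : (x != 0) || (y != 0) -> `|coordD E x y| <= M.
Proof.
move=> xy; have /andP[a0 aM] := coordA_bound xy.
have M0 : 0 <= M by exact: le_trans M1.
rewrite -(ler_pXn2r (n := 2)) ?nnegrE // real_normK ?num_real // coordDE //.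
apply: (@le_trans _ _ M).
  by rewrite lerBlDr ler_wpDr // mulr_ge0 ?sqr_ge0 // ltW.
by rewrite -[leLHS]expr1 ler_weXn2l.
Qed.

Section Step.
Variables (l sig : R).
Hypotheses (l0 : 0 < l) (lK : 60 * 10 * 10 * M ^+ 5 * l <= 1 / 2)
  (sE : sig = 60 * 10 * 10 * M ^+ 5 * l).

Lemma sig_range : 0 <= sig <= 1 / 2.
Proof.
rewrite sE lK andbT.
have : 0 <= M ^+ 5 * l.
  by apply: mulr_ge0; [apply: exprn_ge0; exact: le_trans M1|exact: ltW].
by lra.
Qed.

Lemma l_small : 6 * M * l <= 1 / 10 /\ l <= 1 / 10.
Proof.
have M5 : M <= M ^+ 5 by rewrite -[leLHS]expr1 ler_weXn2l.
have : M * l <= M ^+ 5 * l by rewrite ler_pM2r.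
have : 1 * l <= M * l by rewrite ler_pM2r.
move: lK => h0 h1 h2; split.
  by lra.
by lra.
Qed.

Lemma weight_bound (x y : R) : (x != 0) || (y != 0) ->
  1 / 2 <= weight sig l E x y <= 2.
Proof.
move=> xy.
have nb := corr_bound M1 E2 EM q0 qM sig_range (coordA_norm xy) (coordD_norm xy).
have : `|l ^+ 2 * corr sig E (coordA E x y) (coordD E x y)| <= 1 / 2.
  rewrite normrM [`|l ^+ 2|]ger0_norm ?sqr_ge0 //.
  apply: le_trans (ler_wpM2l (sqr_ge0 l) nb) _.
  have [_ l1] := l_small.
  have M4 : M ^+ 4 <= M ^+ 5 by rewrite ler_weXn2l.
  have h1 : l ^+ 2 * M ^+ 4 <= l ^+ 2 * M ^+ 5 by rewrite ler_wpM2l ?sqr_ge0.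
  have h2 : l * (M ^+ 5 * l) <= 1 * (M ^+ 5 * l).
    apply: ler_wpM2r; last by lra.
    by apply: mulr_ge0; [apply: exprn_ge0; exact: le_trans M1|exact: ltW].
  by move: h1 h2 lK; rewrite !expr2; lra.
by rewrite /weight ler_norml => /andP[? ?]; apply/andP; split; lra.
Qed.

(** By homogeneity the power of [qform E x y] factors out. Bounding the remaining power of [1 + t e]
    by [frac] leaves exactly the inequality of [drift_avg] for the direction of [(x, y)]. *)
Lemma lyap_step (x y : R) : (x != 0) || (y != 0) ->
  (lyap sig l E ((E - l) * x - y) x + lyap sig l E ((E + l) * x - y) x) / 2
  <= (1 - l ^+ 3) * lyap sig l E x y.
Proof.
move=> xy; have Q0 := qform_gt0 q0 xy.
have Qn : qform E x y != 0 by rewrite gt_eqF.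
pose A := coordA E x y; pose D := coordD E x y.
pose x1 e := (E - l * e) * x - y.
pose t e := l ^+ 2 * A - 2 * l * e * D.
have xy1 e : (x1 e != 0) || (x != 0).
  rewrite /x1; case: (eqVneq x 0) xy => [->|] /=; last by rewrite orbT.
  by rewrite mulr0 sub0r oppr_eq0 orbF.
have Q1 e : e ^+ 2 = 1 -> qform E (x1 e) x = qform E x y * (1 + t e).
  move=> e2; rewrite /t /A /D /coordA /coordD mulrDr mulr1 mulrBr.
  have -> : qform E x y * (l ^+ 2 * (x ^+ 2 / qform E x y)) = l ^+ 2 * x ^+ 2 * e ^+ 2.
    by rewrite e2; field.
  have -> : qform E x y * (2 * l * e * (x * (E / 2 * x - y) / qform E x y)) =
    2 * l * e * (x * (E / 2 * x - y)) by field.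
  by rewrite /qform /x1; field.
have t0 e : e ^+ 2 = 1 -> 0 < 1 + t e.
  by move=> e2; rewrite -(pmulr_rgt0 _ Q0) -Q1 // qform_gt0.
(* The value [e = 0] gives the free step, which preserves [Q]; this identifies [freeA] and
   [freeD]. *)
have x10 : x1 0 = E * x - y by rewrite /x1 mulr0 subr0.
have Q10 : qform E (x1 0) x = qform E x y by rewrite x10 /qform; ring.
have A0 : freeA E A D = coordA E (x1 0) x.
  rewrite /freeA /A /D /coordA /coordD Q10 x10; apply: (mulIf Qn).
  rewrite mulfVK //.
  have -> : (1 + E * (x * (E / 2 * x - y) / qform E x y) +
    (1 - 2 * sin2 E) * (x ^+ 2 / qform E x y)) * qform E x y =
    qform E x y + E * (x * (E / 2 * x - y)) + (1 - 2 * sin2 E) * x ^+ 2 by field.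
  by rewrite /qform /sin2; field.
have D0 : freeD E A D = coordD E (x1 0) x.
  rewrite /freeD A0 /A /D /coordA /coordD Q10 x10; apply: (mulIf Qn).
  by rewrite mulfVK //; field.
have h e : e ^+ 2 = 1 -> [/\ t e = l ^+ 2 * A - 2 * l * e * D,
    `|coordA E (x1 e) x| <= M, `|coordD E (x1 e) x| <= M,
    (1 + t e) * coordA E (x1 e) x =
      freeA E A D - 2 * l * e * (E / 2 * A + D) + l ^+ 2 * A &
    (1 + t e) * coordD E (x1 e) x =
      E / 2 * ((1 + t e) * coordA E (x1 e) x) - (E / 2 * A + D) + l * e * A].
  move=> e2; have tn := gt_eqF (t0 _ e2).
  split=> //; [exact: coordA_norm|exact: coordD_norm| | ].
    have x2 : x1 e ^+ 2 = (E * x - y) ^+ 2 - 2 * l * e * (x * (E * x - y))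
        + l ^+ 2 * x ^+ 2.
      by rewrite -[l ^+ 2]mulr1 -[X in _ * X * x ^+ 2]e2 /x1; ring.
    rewrite A0 /coordA Q1 // Q10 /A /D /coordA /coordD x10 x2.
    by field; rewrite Qn tn.
  rewrite /coordA /coordD Q1 // /A /D /coordA /coordD /x1.
  by field; rewrite Qn tn.
have avg := drift_avg M1 E2 EM q0 qM E0 l0 lK sE (coordA_norm xy) (coordD_norm xy)
  (coordDE q0 xy).
have := avg (fun e => coordA E (x1 e) x) (fun e => coordD E (x1 e) x) t.
rewrite -/A -/D A0 D0 -A0 -D0 => /(_ _ _ h).
rewrite {1}A0 {1}D0 => /(_ (coordA_norm (xy1 _)) (coordD_norm (xy1 _))) {}avg.
have step e : e ^+ 2 = 1 -> lyap sig l E (x1 e) x <= qform E x y `^ (sig - 1) *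
    (frac sig (t e) * weight sig l E (x1 e) x).
  move=> e2; rewrite /lyap Q1 // powRM ?(ltW Q0) ?(ltW (t0 _ e2)) // -mulrA.
  apply: ler_wpM2l; first exact: powR_ge0.
  apply: ler_wpM2r; first by have /andP[w0 _] := weight_bound (xy1 e); apply: le_trans w0; lra.
  apply: powR_le_frac; first exact: sig_range.
  have [lM l1] := l_small; rewrite /t.
  have l2 : l ^+ 2 <= l by rewrite expr2 ler_piMr // ?ltW //; lra.
  apply: (@le_trans _ _ (l * M + 2 * l * 1 * M)); last by lra.
  have ne : `|e| <= 1.
    have /eqP : (e - 1) * (e + 1) = 0 by rewrite -subr_sqr e2 expr1n subrr.
    by rewrite mulf_eq0 subr_eq0 addr_eq0 => /orP[]/eqP ->; rewrite ?normrN normr1.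
  apply: normB_le; apply: normM_le; rewrite ?coordA_norm ?coordD_norm //.
    by rewrite normrX gtr0_norm.
  apply: normM_le => //; apply: normM_le; first by rewrite normr_nat.
  by rewrite gtr0_norm.
have -> : (E - l) * x - y = x1 1 by rewrite /x1 mulr1.
have -> : (E + l) * x - y = x1 (-1) by rewrite /x1 mulrN1 opprK.
have m1 : (-1 : R) ^+ 2 = 1 by rewrite sqrrN expr1n.
apply: (@le_trans _ _ (qform E x y `^ (sig - 1) *
  ((frac sig (t 1) * weight sig l E (x1 1) x +
    frac sig (t (-1)) * weight sig l E (x1 (-1)) x) / 2))).
  by rewrite mulrA mulrDr ler_pM2r ?invr_gt0 // lerD ?step ?expr1n.
rewrite /lyap [leRHS]mulrCA; apply: ler_wpM2l; first exact: powR_ge0.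
exact: avg.
Qed.

End Step.
End Bounds.
End Lyapunov.

(** * Two energies *)

Section Gap.
Variable R : realType.

Lemma sqrt_cauchy_schwarz (a b c d : R) : 0 <= a -> 0 <= b -> 0 <= c -> 0 <= d ->
  Num.sqrt (a * b) + Num.sqrt (c * d) <= Num.sqrt ((a + c) * (b + d)).
Proof.
move=> a0 b0 c0 d0.
rewrite -[leLHS]ger0_norm ?addr_ge0 ?sqrtr_ge0 // -sqrtr_sqr; apply: ler_wsqrtr.
rewrite sqrrD !sqr_sqrtr ?mulr_ge0 //.
have -> : Num.sqrt (a * b) * Num.sqrt (c * d) = Num.sqrt (a * d) * Num.sqrt (c * b).
  by rewrite -!sqrtrM ?mulr_ge0 //; congr Num.sqrt; ring.
have : 0 <= (Num.sqrt (a * d) - Num.sqrt (c * b)) ^+ 2 by exact: sqr_ge0.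
by rewrite sqrrB !sqr_sqrtr ?mulr_ge0 //; lra.
Qed.

(** Each of the fractions [a / (a + b)] and [b / (a + b)] is at most its [s]-th power, and they add
    up to 1. *)
Lemma powR_subadd (s a b : R) : 0 <= s <= 1 -> 0 <= a -> 0 <= b ->
  (a + b) `^ s <= a `^ s + b `^ s.
Proof.
move=> /andP[s0 s1] a0 b0; have [ab0|ab0] := eqVneq (a + b) 0.
  have /andP[/eqP-> /eqP->] : (a == 0) && (b == 0) by rewrite -paddr_eq0 // ab0.
  by rewrite addr0 lerDl powR_ge0.
have p : 0 < a + b by rewrite lt_neqAle eq_sym ab0 addr_ge0.
have h c : 0 <= c -> c <= a + b -> c / (a + b) * (a + b) `^ s <= c `^ s.
  move=> c0 cab; have [->|cn] := eqVneq c 0; first by rewrite !mul0r powR_ge0.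
  rewrite -[in leRHS](divfK ab0 c) powRM ?divr_ge0 ?(ltW p) //.
  apply: ler_wpM2r; first exact: powR_ge0.
  apply: ger1_powR => //; apply/andP; split; last by rewrite ler_pdivrMr ?mul1r.
  by apply: divr_gt0 => //; rewrite lt_neqAle eq_sym cn.
have ha : a <= a + b by rewrite lerDl.
have hb : b <= a + b by rewrite lerDr.
apply: le_trans (lerD (h _ a0 ha) (h _ b0 hb)).
by rewrite -mulrDl -mulrDl divff // mul1r.
Qed.

(* With [s = 1 - sig], up to the bounded weights this is the [s]-th power of the sine
   of the angle between [(x, y)] and [(x', y')]. *)
Definition gap (sig l E E' x y x' y' : R) : R :=
  `|x * y' - y * x'| `^ (1 - sig) * Num.sqrt (lyap sig l E x y * lyap sig l E' x' y').

Section Bounds.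
Variables (M E E' : R).
Hypotheses (M1 : 1 <= M).
Hypotheses (E0 : E != 0) (E2 : `|E| <= 2) (EM : `|E^-1| <= M).
Hypotheses (q0 : 0 < sin2 E) (qM : (sin2 E)^-1 <= M).
Hypotheses (E0' : E' != 0) (E2' : `|E'| <= 2) (EM' : `|E'^-1| <= M).
Hypotheses (q0' : 0 < sin2 E') (qM' : (sin2 E')^-1 <= M).
Variables (l sig : R).
Hypotheses (l0 : 0 < l) (lK : 60 * 10 * 10 * M ^+ 5 * l <= 1 / 2)
  (sE : sig = 60 * 10 * 10 * M ^+ 5 * l).

(** The powers of [x] and [Q] combine to a power of [coordA], which is bounded. This controls the
    term [(E - E') * (x * x')] that a step adds to the Wronskian. *)
Lemma lyap_mul_bound (F x y : R) : F != 0 -> `|F| <= 2 -> `|F^-1| <= M ->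
  0 < sin2 F -> (sin2 F)^-1 <= M ->
  (x != 0) || (y != 0) -> 0 <= lyap sig l F x y /\
  (`|x| `^ (1 - sig)) ^+ 2 * lyap sig l F x y <= 2 * M.
Proof.
move=> F0 F2 FM p0 pM xy; have /andP[s0 s1] := sig_range M1 l0 lK sE.
have /andP[w0 w1] := weight_bound M1 F2 FM p0 pM l0 lK sE xy.
have w00 : 0 <= weight sig l F x y by apply: le_trans w0; lra.
have Q0 := qform_gt0 p0 xy.
split; first by rewrite mulr_ge0 ?powR_ge0.
have -> : (`|x| `^ (1 - sig)) ^+ 2 * lyap sig l F x y =
  coordA F x y `^ (1 - sig) * weight sig l F x y.
  rewrite /lyap /coordA mulrA; congr (_ * _).
  rewrite expr2 -powRM // -expr2 real_normK ?num_real //.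
  rewrite powRM ?sqr_ge0 ?invr_ge0 ?(ltW Q0) //; congr (_ * _).
  by rewrite -powR_inv1 ?(ltW Q0) // -powRrM; congr (_ `^ _); ring.
have /andP[a0 aM] := coordA_bound p0 pM xy.
rewrite mulrC; apply: ler_pM => //; first exact: powR_ge0.
apply: (@le_trans _ _ (M `^ (1 - sig))).
  apply: ge0_ler_powR; rewrite ?nnegrE //; last exact: le_trans M1.
  by lra.
by apply: ler1_powR => //; lra.
Qed.

(** The common potential cancels in the Wronskian, so both spins give the same new value, and
    subadditivity of the power separates the increment. The mean of the square roots contracts by
    Cauchy-Schwarz and [lyap_step] at each energy. *)
Lemma gap_step (x y x' y' : R) : (x != 0) || (y != 0) -> (x' != 0) || (y' != 0) ->
  (gap sig l E E' ((E - l) * x - y) x ((E' - l) * x' - y') x' +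
   gap sig l E E' ((E + l) * x - y) x ((E' + l) * x' - y') x') / 2
  <= (1 - l ^+ 3) * gap sig l E E' x y x' y' + 2 * M * `|E - E'| `^ (1 - sig).
Proof.
move=> xy xy'; have /andP[s0 s1] := sig_range M1 l0 lK sE.
have [_ l1] := l_small M1 l0 lK.
have l3 : 0 <= l ^+ 3 <= 1 by rewrite exprn_ge0 ?exprn_ile1 ?(ltW l0) //; lra.
have nz (F a b : R) : (a != 0) || (b != 0) -> (F * a - b != 0) || (a != 0).
  by case: (eqVneq a 0) => [->|_] /=; rewrite ?orbT // mulr0 sub0r oppr_eq0 orbF.
pose W := x * y' - y * x'.
have st c : ((E - c) * x - y) * x' - x * ((E' - c) * x' - y')
  = W + (E - E') * (x * x') by rewrite /W; ring.
have stp : ((E + l) * x - y) * x' - x * ((E' + l) * x' - y')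
  = W + (E - E') * (x * x') by rewrite /W; ring.
rewrite /gap st stp -mulrDr -mulrA.
have hL F a b := @lyap_mul_bound F a b.
have [A0 AM] := hL _ _ _ E0 E2 EM q0 qM xy.
have [B0 BM] := hL _ _ _ E0' E2' EM' q0' qM' xy'.
have [Ap _] := hL _ _ _ E0 E2 EM q0 qM (nz (E - l) _ _ xy).
have [Bp _] := hL _ _ _ E0' E2' EM' q0' qM' (nz (E' - l) _ _ xy').
have [Am _] := hL _ _ _ E0 E2 EM q0 qM (nz (E + l) _ _ xy).
have [Bm _] := hL _ _ _ E0' E2' EM' q0' qM' (nz (E' + l) _ _ xy').
have sA := lyap_step M1 E0 E2 EM q0 qM l0 lK sE xy.
have sB := lyap_step M1 E0' E2' EM' q0' qM' l0 lK sE xy'.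
move: Ap Bp Am Bm sA sB.
set ap := lyap _ _ E ((E - l) * x - y) _; set am := lyap _ _ E ((E + l) * x - y) _.
set bp := lyap _ _ E' ((E' - l) * x' - y') _.
set bm := lyap _ _ E' ((E' + l) * x' - y') _.
set a := lyap _ _ E x y in A0 AM *; set b := lyap _ _ E' x' y' in B0 BM *.
move=> Ap Bp Am Bm sA sB.
have avg : (Num.sqrt (ap * bp) + Num.sqrt (am * bm)) / 2 <=
    (1 - l ^+ 3) * Num.sqrt (a * b).
  apply: le_trans (_ : Num.sqrt ((ap + am) * (bp + bm)) / 2 <= _).
    by rewrite ler_pM2r ?invr_gt0 //; exact: sqrt_cauchy_schwarz.
  have -> : Num.sqrt ((ap + am) * (bp + bm)) / 2 =
            Num.sqrt ((ap + am) / 2 * ((bp + bm) / 2)).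
    have -> : (ap + am) / 2 * ((bp + bm) / 2) =
              (ap + am) * (bp + bm) * 2^-1 ^+ 2 by field.
    by rewrite [RHS]sqrtrM ?mulr_ge0 ?addr_ge0 // sqrtr_sqr gtr0_norm ?invr_gt0.
  have c0 : 0 <= 1 - l ^+ 3 by rewrite subr_ge0; case/andP: l3.
  have -> : (1 - l ^+ 3) * Num.sqrt (a * b) =
     Num.sqrt (((1 - l ^+ 3) * a) * ((1 - l ^+ 3) * b)).
    have -> : (1 - l ^+ 3) * a * ((1 - l ^+ 3) * b) = (1 - l ^+ 3) ^+ 2 * (a * b).
      by ring.
    by rewrite [RHS]sqrtrM ?sqr_ge0 // sqrtr_sqr ger0_norm.
  by apply: ler_wsqrtr; apply: ler_pM => //; rewrite divr_ge0 ?addr_ge0.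
have sub : `|W + (E - E') * (x * x')| `^ (1 - sig) <=
    `|W| `^ (1 - sig) + `|E - E'| `^ (1 - sig) * `|x * x'| `^ (1 - sig).
  rewrite -powRM // -normrM; apply: (le_trans _ (powR_subadd _ _ _)) => //; last first.
    by apply/andP; split; lra.
  apply: ge0_ler_powR; rewrite ?nnegrE; [by lra|by []|exact: addr_ge0|].
  exact: ler_normD.
apply: (@le_trans _ _ ((`|W| `^ (1 - sig) + `|E - E'| `^ (1 - sig) * `|x * x'| `^ (1 - sig))
   * ((1 - l ^+ 3) * Num.sqrt (a * b)))).
  by apply: ler_pM.
rewrite mulrDl mulrCA lerD2l.
rewrite mulrAC -mulrA [2 * M * _]mulrC; apply: ler_wpM2l; first exact: powR_ge0.
rewrite mulrAC [_ * `|_| `^ _]mulrC -mulrA.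
(* Moved under the root, the powers of [x] and [x'] pair up with their own Lyapunov factors, each
   product being at most [2 * M]. *)
have -> : `|x * x'| `^ (1 - sig) * ((1 - l ^+ 3) * Num.sqrt (a * b)) = 
  (1 - l ^+ 3) * Num.sqrt (((`|x| `^ (1 - sig)) ^+ 2 * a) * ((`|x'| `^ (1 - sig)) ^+ 2 * b)).
  have -> : (`|x| `^ (1 - sig)) ^+ 2 * a * ((`|x'| `^ (1 - sig)) ^+ 2 * b) =
    (`|x| `^ (1 - sig) * `|x'| `^ (1 - sig)) ^+ 2 * (a * b) by ring.
  rewrite mulrCA; congr (_ * _).
  rewrite [RHS]sqrtrM ?sqr_ge0 // sqrtr_sqr -powRM // -normrM.
  by rewrite [X in _ = X * _]ger0_norm ?powR_ge0.
apply: le_trans (_ : 1 * Num.sqrt (2 * M * (2 * M)) <= _); last first.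
  by rewrite mul1r -expr2 sqrtr_sqr ger0_norm // mulr_ge0 // (le_trans _ M1).
case/andP: l3 => l30 l31.
apply: ler_pM; rewrite ?sqrtr_ge0 ?subr_ge0 ?gerBl //.
apply: ler_wsqrtr; apply: ler_pM => //; apply: mulr_ge0 => //; exact: sqr_ge0.
Qed.

End Bounds.
End Gap.

(** * Rotation counting *)

Section Sign.
Variable R : realFieldType.

(** The squared sine of the angle between the two vectors exceeds [1 / 100]. *)
Definition far (x y x' y' : R) : bool :=
  (x ^+ 2 + y ^+ 2) * (x' ^+ 2 + y' ^+ 2) < 100 * (x * y' - y * x') ^+ 2.
(** For nearly parallel directions with opposite flags, this tells whether the axis between them is
    [x = 0] or [y = 0]. *)
Definition steep (x y x' y' : R) : bool := `|x * x'| < `|y * y'|.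
Definition flag_diff (x y x' y' : R) : R :=
  (0 < x' * y')%R%:R - (0 < x * y)%R%:R.

(** Opposite flags make [x * y'] and [y * x'] of opposite signs, so nothing cancels in the Wronskian
    and both are small. The pair not being far gives 99 times the sum of their squares at most
    [2 * (y * y') ^+ 2], whence the constant [49 = 7 ^ 2]. *)
Lemma near_axis (x y x' y' : R) : (x * y) * (x' * y') < 0 ->
  `|x * x'| <= `|y * y'| -> ~~ far x y x' y' -> 7 * `|x| <= `|y| /\ 7 * `|x'| <= `|y'|.
Proof.
move=> op st; rewrite -leNgt => fr.
have st2 : (x * x') ^+ 2 <= (y * y') ^+ 2.
  rewrite -[(x * x') ^+ 2]real_normK ?num_real // -[(y * y') ^+ 2]real_normK ?num_real //.
  by rewrite lerXn2r ?nnegrE.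
have W2 : (x * y') ^+ 2 + (y * x') ^+ 2 <= (x * y' - y * x') ^+ 2.
  rewrite [leRHS](_ : _ = (x * y') ^+ 2 + (y * x') ^+ 2 - 2 * ((x * y) * (x' * y'))); last by ring.
  by rewrite lerDl oppr_ge0 nmulr_lle0 // ?ltW // mulr_ge0_le0 // ltW.
have key : 49 * ((x * y') ^+ 2 + (y * x') ^+ 2) <= (y * y') ^+ 2.
  have e : (x ^+ 2 + y ^+ 2) * (x' ^+ 2 + y' ^+ 2) = (x * x') ^+ 2 + (y * y') ^+ 2
    + ((x * y') ^+ 2 + (y * x') ^+ 2) by ring.
  by move: fr; rewrite e; have := sqr_ge0 (y * y'); lra.
have h1 : 7 * `|x * y'| <= `|y * y'|.
  rewrite -(ler_pXn2r (n := 2)) ?nnegrE ?mulr_ge0 // exprMn !real_normK ?num_real //.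
  by have := sqr_ge0 (y * x'); lra.
have h2 : 7 * `|y * x'| <= `|y * y'|.
  rewrite -(ler_pXn2r (n := 2)) ?nnegrE ?mulr_ge0 // exprMn !real_normK ?num_real //.
  by have := sqr_ge0 (x * y'); lra.
have y0 : 0 < `|y|.
  by rewrite normr_gt0; apply: contraTneq op => ->; rewrite mulr0 mul0r ltxx.
have y0' : 0 < `|y'|.
  by rewrite normr_gt0; apply: contraTneq op => ->; rewrite !mulr0 ltxx.
split.
  by move: h1; rewrite !normrM mulrA ler_pM2r.
by move: h2; rewrite !normrM mulrCA ler_pM2l.
Qed.

Lemma step_opposite (a x y z : R) : `|a| <= 3 -> z = a * x - y -> y != 0 ->
  7 * `|x| <= `|y| -> z * y < 0 /\ `|x| < `|z|.
Proof.
move=> a3 -> y0 xy.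
have ax : `|a * x| <= 3 * `|x| by rewrite normrM ler_wpM2r.
have yp : 0 < `|y| by rewrite normr_gt0.
have y2 : y ^+ 2 = `|y| ^+ 2 by rewrite real_normK ?num_real.
split.
  have : a * x * y <= 3 * `|x| * `|y|.
    by apply: le_trans (ler_norm _) _; rewrite normrM ler_wpM2r.
  have : 7 * `|x| * `|y| <= `|y| ^+ 2 by rewrite expr2 ler_pM2r.
  have : 0 < `|y| ^+ 2 by rewrite exprn_gt0.
  have : 0 <= `|x| * `|y| by exact: mulr_ge0.
  by rewrite mulrBl -expr2 y2; lra.
have := lerB_dist (a * x) y; rewrite distrC => h.
have := lerB_dist y (a * x).
have := normr_ge0 x; rewrite -[`|y - a * x|]normrN opprB.
by lra.
Qed.

(* If the two directions stay almost parallel, a discrepancy of the Sturm flags is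
   created when one of them crosses the axis [x = 0] and undone one step later at
   the axis [y = 0]; it is a coboundary of [flag_diff * steep]. *)
Lemma flag_transfer (a x y z a' x' y' z' : R) : `|a| <= 3 -> `|a'| <= 3 ->
  z = a * x - y -> z' = a' * x' - y' -> x != 0 -> x' != 0 -> z != 0 -> z' != 0 ->
  ~~ far x y x' y' -> ~~ far z x z' x' ->
  flag_diff z x z' x' - flag_diff z x z' x' * (steep z x z' x')%:R
  + flag_diff x y x' y' * (steep x y x' y')%:R = 0.
Proof.
move=> a3 a3' ez ez' x0 x0' z0 z0' f1 f2.
have par (u v u' v' : R) : (0 < u' * v') != (0 < u * v) -> u != 0 -> u' != 0 ->
    v != 0 -> v' != 0 -> (u * v) * (u' * v') < 0.
  move=> h u0 u0' v0 v0'.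
  have n : u * v != 0 by rewrite mulf_neq0.
  have n' : u' * v' != 0 by rewrite mulf_neq0.
  move: h; case: (ltgtP 0 (u * v)) n => // h _; case: (ltgtP 0 (u' * v')) n' => // h' _ _.
    by rewrite pmulr_rlt0.
  by rewrite nmulr_rlt0.
have opp (u v w : R) : u != 0 -> w * v < 0 -> (0 < w * u) = ~~ (0 < u * v).
  move=> u0 wv; have u2 : 0 < u ^+ 2 by rewrite exprn_even_gt0.
  have : (w * u) * (u * v) < 0.
    by rewrite [ltLHS](_ : _ = u ^+ 2 * (w * v)); [rewrite pmulr_rlt0|ring].
  have [uv|uv|uv] := ltgtP 0 (u * v).
  - by rewrite pmulr_llt0 // => /lt_gtF->.
  - by rewrite nmulr_llt0 // => ->.
  - by rewrite -uv mulr0 ltxx.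
(* Creation at the axis [x = 0]: the step reverses both flags and leaves a pair that is not steep,
   so the two contributions cancel. *)
have [/andP[op st]|ne] := boolP (((x * y) * (x' * y') < 0) && steep x y x' y').
  have [h h'] := near_axis op (ltW st) f1.
  have y0 : y != 0 by apply: contraTneq op => ->; rewrite mulr0 mul0r ltxx.
  have y0' : y' != 0 by apply: contraTneq op => ->; rewrite !mulr0 ltxx.
  have [zy zx] := step_opposite a3 ez y0 h.
  have [zy' zx'] := step_opposite a3' ez' y0' h'.
  have -> : steep z x z' x' = false.
    by apply/negbTE; rewrite -leNgt !normrM; apply: ler_pM => //; exact: ltW.
  rewrite st /flag_diff (opp _ _ _ x0 zy) (opp _ _ _ x0' zy').
  by do 2?case: (0 < _); rewrite /=; ring.
have -> : flag_diff x y x' y' * (steep x y x' y')%:R = 0.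
  rewrite /flag_diff; have [st|] := boolP (steep x y x' y'); last by rewrite mulr0.
  have [->|df] := eqVneq (0 < x' * y') (0 < x * y); first by rewrite subrr mul0r.
  have yy : 0 < `|y * y'| by apply: le_lt_trans st.
  move: yy; rewrite normr_gt0 mulf_eq0 negb_or => /andP[y0 y0'].
  by move: ne; rewrite (par _ _ _ _ df x0 x0' y0 y0') st.
rewrite addr0; have [->|df] := eqVneq (flag_diff z x z' x') 0; first by rewrite mul0r subrr.
have {}df : (0 < z' * x') != (0 < z * x).
  by apply: contra df => /eqP h; rewrite /flag_diff h subrr.
have [st|st] := boolP (steep z x z' x'); first by rewrite mulr1 subrr.
(* A discrepancy at the axis [y = 0] has a predecessor: running the step backwards, with the
   coordinates exchanged, shows that the previous pair was steep with opposite flags. *)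
exfalso; have op := par _ _ _ _ df z0 z0' x0 x0'.
move: st; rewrite -leNgt => st.
have f2' : ~~ far x z x' z'.
  move: f2; rewrite /far -!leNgt.
  rewrite [100 * _](_ : _ = 100 * (x * z' - z * x') ^+ 2); last by ring.
  by rewrite [z ^+ 2 + _]addrC [z' ^+ 2 + _]addrC.
have [|h h'] := @near_axis x z x' z' _ st f2'.
  by rewrite [ltLHS](_ : _ = z * x * (z' * x')) //; ring.
have ey : y = a * x - z by rewrite ez; ring.
have ey' : y' = a' * x' - z' by rewrite ez'; ring.
have [yz xy] := step_opposite a3 ey z0 h.
have [yz' xy'] := step_opposite a3' ey' z0' h'.
move/negP: ne; apply; apply/andP; split; last by rewrite /steep !normrM ltr_pM.
rewrite [ltLHS](_ : _ = (y * x) * (y' * x')); last by ring.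
have := opp _ _ _ x0 yz; have := opp _ _ _ x0' yz'.
move=> o o'; apply: par => //.
- by rewrite o o' ![x * _]mulrC ![x' * _]mulrC (inj_eq negb_inj).
- by apply: contraTneq yz => ->; rewrite mul0r ltxx.
- by apply: contraTneq yz' => ->; rewrite mul0r ltxx.
Qed.

End Sign.

(** * Lower bound of the gap at a large angle *)

Section FarGap.
Variable R : realType.
Variables (M E E' : R).
Hypotheses (M1 : 1 <= M).
Hypotheses (E2 : `|E| <= 2) (EM : `|E^-1| <= M).
Hypotheses (q0 : 0 < sin2 E) (qM : (sin2 E)^-1 <= M).
Hypotheses (E2' : `|E'| <= 2) (EM' : `|E'^-1| <= M).
Hypotheses (q0' : 0 < sin2 E') (qM' : (sin2 E')^-1 <= M).
Variables (l sig : R).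
Hypotheses (l0 : 0 < l) (lK : 60 * 10 * 10 * M ^+ 5 * l <= 1 / 2)
  (sE : sig = 60 * 10 * 10 * M ^+ 5 * l).

Lemma lyap_ge (F x y : R) : `|F| <= 2 -> `|F^-1| <= M ->
  0 < sin2 F -> (sin2 F)^-1 <= M -> (x != 0) || (y != 0) ->
  1 / 2 * (2 * (x ^+ 2 + y ^+ 2)) `^ (sig - 1) <= lyap sig l F x y.
Proof.
move=> F2 FM p0 pM xy; have /andP[s0 s1] := sig_range M1 l0 lK sE.
have /andP[w0 w1] := weight_bound M1 F2 FM p0 pM l0 lK sE xy.
have Q0 := qform_gt0 p0 xy.
rewrite /lyap [leRHS]mulrC; apply: ler_pM; [by lra|exact: powR_ge0|by []|].
have QN : qform F x y <= 2 * (x ^+ 2 + y ^+ 2).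
  have : - (F * (x * y)) <= 2 * (`|x| * `|y|).
    by apply: le_trans (ler_norm _) _; rewrite normrN !normrM ler_wpM2r ?mulr_ge0.
  have := sqr_ge0 (`|x| - `|y|); rewrite sqrrB !real_normK ?num_real // /qform.
  by lra.
rewrite -[sig - 1]opprB !powRN lef_pV2 ?posrE ?powR_gt0 //.
  apply: ge0_ler_powR; rewrite ?nnegrE //; [by lra|exact: ltW|].
  by apply: le_trans QN; exact: ltW.
exact: lt_le_trans QN.
Qed.

(** The squared gap is at least [1 / 4] times the power [1 - sig] of [1 / 400], hence at least
    [1 / 1600], the square of [1 / 40]. *)
Lemma far_gap (x y x' y' : R) : (x != 0) || (y != 0) -> (x' != 0) || (y' != 0) ->
  far x y x' y' -> 1 <= 40 * gap sig l E E' x y x' y'.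
Proof.
move=> xy xy' fr; have /andP[s0 s1] := sig_range M1 l0 lK sE.
have h := lyap_ge E2 EM q0 qM xy; have h' := lyap_ge E2' EM' q0' qM' xy'.
set n := x ^+ 2 + y ^+ 2 in h; set n' := x' ^+ 2 + y' ^+ 2 in h'.
pose W := x * y' - y * x'.
have n0 : 0 <= n by rewrite addr_ge0 ?sqr_ge0.
have n0' : 0 <= n' by rewrite addr_ge0 ?sqr_ge0.
have nn : 0 < n * n'.
  have pos (u v : R) : (u != 0) || (v != 0) -> 0 < u ^+ 2 + v ^+ 2.
    move=> uv; rewrite lt_neqAle addr_ge0 ?sqr_ge0 // andbT eq_sym.
    by rewrite paddr_eq0 ?sqr_ge0 // !sqrf_eq0 negb_and.
  by rewrite mulr_gt0 ?pos.
have g0 : 0 <= gap sig l E E' x y x' y' by rewrite mulr_ge0 ?powR_ge0 ?sqrtr_ge0.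
rewrite -(ler_pXn2r (n := 2)) ?nnegrE ?mulr_ge0 // expr1n exprMn.
have e : gap sig l E E' x y x' y' ^+ 2 =
    (W ^+ 2) `^ (1 - sig) * (lyap sig l E x y * lyap sig l E' x' y').
  rewrite /gap exprMn sqr_sqrtr.
    by rewrite [in LHS]expr2 -powRM // -expr2 real_normK ?num_real.
  by apply: mulr_ge0; [apply: le_trans h|apply: le_trans h']; rewrite mulr_ge0 ?powR_ge0.
rewrite e.
apply: (@le_trans _ _ (40 ^+ 2 * ((n * n' / 100) `^ (1 - sig) *
   (1 / 2 * (2 * n) `^ (sig - 1) * (1 / 2 * (2 * n') `^ (sig - 1)))))); last first.
  apply: ler_wpM2l; first exact: sqr_ge0.
  apply: ler_pM; rewrite ?powR_ge0 ?mulr_ge0 ?powR_ge0 //.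
    apply: ge0_ler_powR; rewrite ?nnegrE.
    - by lra.
    - by rewrite divr_ge0 ?mulr_ge0.
    - exact: sqr_ge0.
    - by rewrite ler_pdivrMr // [leRHS]mulrC; exact: ltW fr.
  by apply: ler_pM; rewrite ?mulr_ge0 ?powR_ge0.
have -> : (n * n' / 100) `^ (1 - sig) *
   (1 / 2 * (2 * n) `^ (sig - 1) * (1 / 2 * (2 * n') `^ (sig - 1))) =
   1 / 4 * ((n * n' / 100) `^ (1 - sig) * (2 * n * (2 * n')) `^ (sig - 1)).
  by rewrite [(2 * n * _) `^ _]powRM ?mulr_ge0 //; field.
have inv (B t : R) : 0 <= B -> B `^ (- t) = B^-1 `^ t.
  by move=> B0; rewrite -mulN1r powRrM powR_inv1.
rewrite -[sig - 1]opprB inv ?mulr_ge0 // -powRM ?invr_ge0 ?divr_ge0 ?mulr_ge0 //.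
have nz : n * n' != 0 by rewrite gt_eqF.
have [n1 n1'] : n != 0 /\ n' != 0 by move: nz; rewrite mulf_eq0 negb_or => /andP[].
have -> : n * n' / 100 / (2 * n * (2 * n')) = 400^-1.
  by field; rewrite n1 n1'.
have : 400^-1 <= (400^-1 : R) `^ (1 - sig).
  by apply: ger1_powR; [apply/andP; split; lra|lra].
by lra.
Qed.

End FarGap.

(** * Sturm sequences of Jacobi matrices *)

Section Jacobi.
Variable R : rcfType.

(** Characteristic polynomials of the Jacobi matrix with diagonal [d] and unit off-diagonal entries,
    and of the same matrix without its first site. The initial pair [(1, 0)] encodes the Dirichlet
    condition beyond the last site. *)
Fixpoint jacobi_pair (d : seq R) : {poly R} * {poly R} :=
  if d is c :: d' then
    (('X - c%:P) * (jacobi_pair d').1 - (jacobi_pair d').2, (jacobi_pair d').1)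
  else (1, 0).

Local Notation jac d := (jacobi_pair d).1.
Local Notation jac' d := (jacobi_pair d).2.

Lemma jacobi_size (d : seq R) : [/\ size (jac d) = (size d).+1, jac d \is monic &
  (size (jac' d) <= size d)%N].
Proof.
elim: d => [|c d [sz mon sz']] /=; first by rewrite size_poly1 size_poly0 monic1.
have nz : jac d != 0 by rewrite monic_neq0.
have s1 : size (('X - c%:P) * jac d)%R = (size d).+2.
  by rewrite size_mul ?polyXsubC_eq0 // size_XsubC sz.
have lt : (size (- jac' d)%R < size (('X - c%:P) * jac d)%R)%N.
  by rewrite size_polyN s1 ltnS (leq_trans sz').
rewrite size_polyDl // s1 sz leqnn; split=> //.
by rewrite monicE lead_coefDl // -monicE monicMl ?monicXsubC.
Qed.

Lemma jacobi_monic (d : seq R) : jac d \is monic.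
Proof. by have [] := jacobi_size d. Qed.

Lemma jacobi_neq0 (d : seq R) : jac d != 0.
Proof. by rewrite monic_neq0 ?jacobi_monic. Qed.

(* Christoffel-Darboux: the Wronskian is the sum of the squares of the shorter
   continuants. *)
Lemma jacobi_wronskian (d : seq R) (x : R) : d != [::] ->
  0 < (jac d)^`().[x] * (jac' d).[x] - (jac d).[x] * (jac' d)^`().[x].
Proof.
suff H : (d != [::] -> 0 < (jac d)^`().[x] * (jac' d).[x] - (jac d).[x] * (jac' d)^`().[x])
   /\ 0 <= (jac d)^`().[x] * (jac' d).[x] - (jac d).[x] * (jac' d)^`().[x] by apply H.
elim: d => [|c d [IH IH0]] /=; first by split=> //; rewrite deriv0 !horner0 !mulr0 subrr.
suff h : 0 < (('X - c%:P) * jac d - jac' d)^`().[x] * (jac d).[x] -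
  (('X - c%:P) * jac d - jac' d).[x] * (jac d)^`().[x] by split; [|exact: ltW].
set rhs := (X in 0 < X).
have -> : rhs = (jac d).[x] ^+ 2 +
   ((jac d)^`().[x] * (jac' d).[x] - (jac d).[x] * (jac' d)^`().[x]).
  rewrite /rhs derivB derivM derivXsubC mul1r.
  by rewrite !(hornerD, hornerN, hornerM, hornerXsubC); ring.
case: d IH IH0 {rhs} => [|c' d] IH IH0; last by rewrite ltr_wpDl ?sqr_ge0 ?IH.
by rewrite /= deriv0 !horner0 !mulr0 subrr addr0 hornerC expr1n.
Qed.

Lemma jacobi_simple_root (d : seq R) (x : R) : root (jac d) x ->
  0 < (jac d)^`().[x] * (jac' d).[x].
Proof.
move=> rx; have d0 : d != [::] by apply: contraTneq rx => -> /=; rewrite root1.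
by have := jacobi_wronskian x d0; move/eqP: rx => ->; rewrite mul0r subr0.
Qed.

Lemma jacobi_mup (d : seq R) (x : R) : root (jac d) x -> mup x (jac d) = 1%N.
Proof.
move=> rx; have := jacobi_simple_root rx; have nz := jacobi_neq0 d.
move: (rx); rewrite -dvdp_XsubCl XsubC_dvd // => m0 h.
apply/eqP; rewrite eqn_leq m0 andbT leqNgt.
apply: contraTN h => m2; rewrite -leNgt; suff -> : (jac d)^`().[x] = 0 by rewrite mul0r.
move: m2; rewrite mup_geq // => /dvdpP[q ->].
rewrite expr2 mulrA derivM derivXsubC mulr1.
by rewrite hornerD !hornerM hornerXsubC subrr !mulr0 addr0.
Qed.

Lemma jacobi_jump (d : seq R) (x : R) : root (jac d) x -> jump (jac' d) (jac d) x = 1.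
Proof.
move=> rx; have h := jacobi_simple_root rx.
have d'0 : ~~ root (jac d)^`() x.
  by apply: contraTN h => /eqP->; rewrite mul0r ltxx.
have q0 : ~~ root (jac' d) x.
  by apply: contraTN h => /eqP->; rewrite mulr0 ltxx.
rewrite /jump (muNroot q0) subn0 (mu_deriv_root (jacobi_neq0 d) rx) (muNroot d'0).
have -> : jac' d != 0 by apply: contraNneq q0 => ->; rewrite root0.
rewrite sgp_right_mul (sgp_rightNroot q0) (sgp_right_deriv rx) (sgp_rightNroot d'0).
by rewrite -sgrM mulrC gtr0_sg // ltr10 expr0.
Qed.

(** Excluding [E] from the roots for every suffix gives all Sturm flags along the recursion a
    definite sign. *)
Fixpoint generic (E : R) (d : seq R) : bool :=
  ~~ root (jac d) E && (if d is _ :: d' then generic E d' else true).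

Lemma generic_root (E : R) (d : seq R) : generic E d -> ~~ root (jac d) E.
Proof. by case: d => [|c d] /andP[]. Qed.

Definition flag (E : R) (d : seq R) : bool := 0 < (jac d).[E] * (jac' d).[E].

(* Sturm: every root of [jac d] has jump [+1], so root counts are Cauchy indices. *)
Lemma roots_flag (a b c : R) (d : seq R) : a < b ->
  generic a (c :: d) -> generic b (c :: d) ->
  (size (roots (jac (c :: d)) a b))%:R = (size (roots (jac d) a b))%:R
   + (flag b (c :: d))%:R - (flag a (c :: d))%:R :> R.
Proof.
move=> ab ga gb.
have cE e : (size (roots (jac e) a b))%:Z = cindex a b (jac' e) (jac e).
  rewrite /cindex big_seq (eq_bigr (fun=> 1)); last first.
    by move=> x /root_roots/jacobi_jump.
  by rewrite -big_seq big_const_seq count_predT iter_addr addr0 natz.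
have ra := generic_root ga; have rb := generic_root gb.
have ra' : ~~ root (jac d) a by case/andP: ga => _ /generic_root.
have rb' : ~~ root (jac d) b by case/andP: gb => _ /generic_root.
have [sz mon sz'] := jacobi_size d.
(* The three-term recursion is a step of Euclid's algorithm with signed remainders, so the Cauchy
   index can be computed recursively. *)
have nm : next_mod (jac (c :: d)) (jac d) = jac' d.
  rewrite /next_mod (monicP mon) expr1n /=.
  rewrite (Pdiv.RingMonic.rmodp_addl_mul_small mon); first by rewrite scaleN1r opprK.
  by rewrite size_polyN sz.
have h : cindex a b (jac' (c :: d)) (jac (c :: d)) =
    cross (jac (c :: d) * jac d) a b + cindex a b (jac' d) (jac d).
  by rewrite -nm; apply: cindex_rec => //; rewrite rootM negb_or ?ra ?rb.
rewrite -!cE in h.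
have -> : (size (roots (jac (c :: d)) a b))%:R = ((size (roots (jac (c :: d)) a b))%:Z)%:~R :> R by [].
rewrite h intrD -pmulrn addrC -addrA; congr (_ + _).
rewrite /flag /cross /variation !hornerM.
have na : (jac (c :: d)).[a] * (jac d).[a] != 0 by rewrite mulf_neq0.
have nb : (jac (c :: d)).[b] * (jac d).[b] != 0 by rewrite mulf_neq0.
rewrite [jac' (c :: d)]/=; move: na nb.
move: ((jac (c :: d)).[a] * _) ((jac (c :: d)).[b] * _) => u v.
case: (ltgtP 0 u) => // u0 _; case: (ltgtP 0 v) => // v0 _ /=.
- by rewrite pmulr_rlt0 // lt_gtF // mulr0 subrr.
- by rewrite pmulr_rlt0 // v0 ltr0_sgz // sub0r.
- by rewrite nmulr_rlt0 // v0 gtr0_sgz // subr0.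
- by rewrite nmulr_rlt0 // lt_gtF // mulr0 subrr.
Qed.

End Jacobi.

(** * Determinants of tridiagonal matrices *)

Section Det.
Variable S : comNzRingType.

Definition tridiag (n : nat) (v : nat -> S) : 'M[S]_n :=
  \matrix_(i < n, j < n) (v i *+ (i == j :> nat) - (i.+1 == j)%:R - (j.+1 == i)%:R).

(** Laplace expansion along the first row, then along the first column of the second minor. *)
Lemma det_tridiag (n : nat) (v : nat -> S) : \det (tridiag n.+2 v) =
  v 0%N * \det (tridiag n.+1 (fun i => v i.+1)) - \det (tridiag n (fun i => v i.+2)).
Proof.
rewrite (expand_det_row _ ord0) !big_ord_recl big1 ?addr0; last first.
  by move=> i _; rewrite !mxE /= !mulr0n !subr0 mul0r.
rewrite /cofactor !mxE /= mulr1n !subr0 mulr0n !sub0r expr0 expr1 mul1r.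
congr (_ * \det _ + _).
  by apply/matrixP => i j; rewrite !mxE.
rewrite !mulNr !mul1r opprK.
set B := (X in \det X = _).
rewrite (expand_det_col B ord0) big_ord_recl big1 ?addr0; last first.
  by move=> i _; rewrite !mxE /= !mulr0n !subr0 mul0r.
rewrite /cofactor !mxE /= mulr0n !sub0r ?subr0 expr0  mul1r oppr0 sub0r mulN1r; congr (- \det _).
by apply/matrixP => i j; rewrite !mxE.
Qed.

Lemma det_tridiag1 (v : nat -> S) : \det (tridiag 1 v) = v 0%N.
Proof. by rewrite det_mx11 !mxE /= mulr1n !subr0. Qed.

End Det.

(** * Eigenvalue counts as root counts *)

Section Eig.
Variable R : realType.

Lemma det_tridiag_jacobi (d : seq R) :
  \det (tridiag (size d) (fun i => 'X - (nth 0 d i)%:P)) = (jacobi_pair d).1.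
Proof.
suff h : \det (tridiag (size d) (fun i => 'X - (nth 0 d i)%:P)) = (jacobi_pair d).1
   /\ (d != [::] -> \det (tridiag (size d).-1 (fun i => 'X - (nth 0 d i.+1)%:P)) = (jacobi_pair d).2).
  by case: h.
elim: d => [|c [|c' d] [IH IH']] /=; first by rewrite det_mx00.
  by rewrite det_tridiag1 det_mx00 mulr1 subr0.
split=> //.
by rewrite det_tridiag; congr (_ * _ - _); [exact: IH|exact: IH'].
Qed.

Lemma char_poly_dirichlet (l : R) (v : int -> R) (n : nat) (d : seq R) :
  size d = n -> (forall i, (i < n)%N -> l * v i.+1%:Z = nth 0 d i) ->
  char_poly (dirichlet_restriction (anderson_op l v) n) = (jacobi_pair d).1.
Proof.
move=> sz hd; rewrite -det_tridiag_jacobi sz /char_poly; congr (\det _).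
apply/matrixP => i j; rewrite !mxE /anderson_op /delta_seq.
have -> : (i.+1%:Z - 1 == j.+1%:Z) = (j.+1 == i :> nat).
  by rewrite -addn1 PoszD addrK eqz_nat eq_sym.
have -> : (i.+1%:Z + 1 == j.+1%:Z) = (i.+1 == j :> nat).
  by rewrite -PoszD addn1 eqz_nat eqSS.
have -> : (i.+1%:Z == j.+1%:Z) = (i == j :> nat) by rewrite eqz_nat eqSS.
rewrite -[i == j]/(i == j :> nat) !polyCD !polyC_natr -hd //.
case: (i == j :> nat); rewrite ?mulr1 ?mulr0 ?mulr1n ?mulr0n ?polyC0; by ring.
Qed.

Lemma finite_eigenvalues (n : nat) (A : 'M[R]_n) (b : R) :
  finite_set [set x : R | eigenvalue A x /\ x <= b].
Proof.
have nz : char_poly A != 0 by rewrite monic_neq0 ?char_poly_monic.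
apply: (sub_finite_set (B := [set` rootsR (char_poly A)])); last exact: finite_seq.
by move=> x [/= ex _]; rewrite /= -roots_on_rootsR //= -eigenvalue_root_char.
Qed.

Lemma num_eigenvaluesD (n : nat) (A : 'M[R]_n) (a b : R) : a <= b ->
  num_eigenvalues_le A b = (num_eigenvalues_le A a +
    (\sum_(x \in [set x : R | eigenvalue A x /\ a < x <= b]) mup x (char_poly A))%R)%N.
Proof.
move=> ab; rewrite /num_eigenvalues_le.
rewrite (fsbigID [set x | x <= a]) /=; last exact: finite_eigenvalues.
congr (_ + _)%N; apply: eq_fsbigl; apply/seteqP; split=> x /=.
- by move=> [[]].
- by move=> [ex xa]; split=> //; split=> //; exact: le_trans ab.
- by move=> [[ex xb] /negP]; rewrite -ltNge => ->.
- by move=> [ex /andP[xa xb]]; split=> //; apply/negP; rewrite -ltNge.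
Qed.

(** Multiplicities are 1 by [jacobi_mup]. As [roots] sees the open interval only, [b] must not be a
    root, while a root at [a] is counted by the first summand. *)
Lemma num_eigenvalues_roots (n : nat) (A : 'M[R]_n) (d : seq R) (a b : R) : a < b ->
  char_poly A = (jacobi_pair d).1 -> ~~ root (jacobi_pair d).1 b ->
  num_eigenvalues_le A b =
    (num_eigenvalues_le A a + size (roots (jacobi_pair d).1 a b))%N.
Proof.
move=> ab cA rb; rewrite (num_eigenvaluesD _ (ltW ab)); congr (_ + _)%N.
have nz := jacobi_neq0 d.
have -> : [set x : R | eigenvalue A x /\ a < x <= b] =
          [set` roots (jacobi_pair d).1 a b].
  apply/seteqP; split=> x /=; rewrite in_roots eigenvalue_root_char cA in_itv nz andbT /=.
    move=> [rx /andP[-> xb]] /=; rewrite rx lt_neqAle xb andbT.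
    by apply: contraNneq rb => <-.
  by move=> /andP[-> /andP[-> xb]]; rewrite ltW.
rewrite -fsbig_seq ?uniq_roots // big_seq (eq_bigr (fun=> 1%N)); last first.
  by move=> x /root_roots rx; rewrite cA jacobi_mup.
by rewrite -big_seq sum1_size.
Qed.

End Eig.

(** * Averages over spin configurations *)

Section Avg.
Variable R : realFieldType.

Fixpoint words (n : nat) : seq (seq bool) :=
  if n is n'.+1 then map (cons true) (words n') ++ map (cons false) (words n')
  else [:: [::]].

Definition avg (n : nat) (F : seq bool -> R) : R :=
  (\sum_(s <- words n) F s) / 2 ^+ n.

Lemma size_words (n : nat) (s : seq bool) : s \in words n -> size s = n.
Proof.
elim: n s => [|n IH] s /=; first by rewrite inE => /eqP->.
by rewrite mem_cat => /orP[]/mapP[t /IH <- ->].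
Qed.

Lemma avg0 (F : seq bool -> R) : avg 0 F = F [::].
Proof. by rewrite /avg /= big_seq1 expr0 divr1. Qed.

Lemma avgS (n : nat) (F : seq bool -> R) :
  avg n.+1 F = avg n (fun s => (F (true :: s) + F (false :: s)) / 2).
Proof.
rewrite /avg /= big_cat !big_map /= -big_split /= -mulr_suml exprS invfM mulrA.
by rewrite -mulrA.
Qed.

Lemma avg_le (n : nat) (F G : seq bool -> R) :
  (forall s, s \in words n -> F s <= G s) -> avg n F <= avg n G.
Proof.
move=> h; rewrite /avg ler_pM2r ?invr_gt0 ?exprn_gt0 //.
by rewrite big_seq [leRHS]big_seq; apply: ler_sum.
Qed.

Lemma avg_cst (n : nat) (c : R) : avg n (fun=> c) = c.
Proof.
elim: n => [|n IH]; first by rewrite avg0.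
by rewrite avgS -[RHS]IH; congr avg; apply: funext => s; field.
Qed.

Lemma avgD (n : nat) (F G : seq bool -> R) :
  avg n (fun s => F s + G s) = avg n F + avg n G.
Proof. by rewrite /avg big_split mulrDl. Qed.

Lemma avgZ (n : nat) (c : R) (F : seq bool -> R) :
  avg n (fun s => c * F s) = c * avg n F.
Proof. by rewrite /avg -mulr_sumr mulrA. Qed.

Fixpoint suffix_sum (F : seq bool -> R) (s : seq bool) : R :=
  F s + (if s is _ :: s' then suffix_sum F s' else 0).

(** A suffix of a uniform word is again uniform, and a word of length [n] has [n.+1] suffixes, the
    empty one included. *)
Lemma avg_suffix_sum (F : seq bool -> R) (B : R) (n : nat) :
  (forall k, avg k F <= B) -> avg n (suffix_sum F) <= n.+1%:R * B.
Proof.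
move=> h; elim: n => [|n IH]; first by rewrite avg0 /= addr0 mul1r -avg0.
have -> : suffix_sum F = fun s => F s + (if s is _ :: s' then suffix_sum F s' else 0).
  by apply: funext => -[].
rewrite avgD -[n.+2]addn1 natrD mulrDl addrC mul1r lerD // avgS.
apply: le_trans IH; rewrite le_eqVlt; apply/orP; left; apply/eqP.
by congr avg; apply: funext => s; field.
Qed.

Lemma suffix_sum_le (F G : seq bool -> R) (s : seq bool) :
  (forall t, F t <= G t) -> suffix_sum F s <= suffix_sum G s.
Proof. by move=> h; elim: s => [|c s IH] /=; rewrite lerD. Qed.

End Avg.

(** * Solutions along a spin word *)

Section Chain.
Variable R : realType.
Variable l : R.

Definition spin (b : bool) : R := if b then 1 else -1.
Definition potential (s : seq bool) : seq R := [seq l * spin b | b <- s].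
(** For a word on the sites [1..n], [solX] and [solY] are the values at sites 0 and 1 of the
    solution with value 1 at [n] and 0 at [n + 1]: it is propagated leftwards, the head of the word
    acting last. *)
Definition solX (E : R) (s : seq bool) : R := (jacobi_pair (potential s)).1.[E].
Definition solY (E : R) (s : seq bool) : R := (jacobi_pair (potential s)).2.[E].

Lemma solX_cons (E : R) (b : bool) (s : seq bool) :
  solX E (b :: s) = (E - l * spin b) * solX E s - solY E s.
Proof. by rewrite /solX /= hornerD hornerN hornerM hornerXsubC. Qed.

Lemma solY_cons (E : R) (b : bool) (s : seq bool) : solY E (b :: s) = solX E s.
Proof. by []. Qed.

Lemma sol_neq0 (E : R) (s : seq bool) : (solX E s != 0) || (solY E s != 0).
Proof.
elim: s => [|b s IH]; first by rewrite /solX /= hornerC oner_eq0.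
rewrite solX_cons solY_cons; case: (eqVneq (solX E s) 0) IH => [->|_] /=.
  by rewrite mulr0 sub0r oppr_eq0 orbF.
by rewrite orbT.
Qed.

Definition count_roots (a b : R) (s : seq bool) : nat :=
  size (roots (jacobi_pair (potential s)).1 a b).

Definition far_at (a b : R) (s : seq bool) : bool :=
  far (solX a s) (solY a s) (solX b s) (solY b s).

Lemma generic_neq0 (E : R) (s : seq bool) : generic E (potential s) -> solX E s != 0.
Proof. by move/generic_root. Qed.

(* The induction carries the count corrected by the coboundary of [flag_transfer]. *)
Lemma count_roots_le (a b : R) (s : seq bool) : a < b -> `|a| <= 2 -> `|b| <= 2 ->
  0 < l <= 1 -> generic a (potential s) -> generic b (potential s) ->
  (count_roots a b s)%:R <= 1 + 4 * suffix_sum (fun t => (far_at a b t)%:R : R) s.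
Proof.
move=> ab a2 b2 /andP[l0 l1].
pose fd t := flag_diff (solX a t) (solY a t) (solX b t) (solY b t).
pose st t : R := (steep (solX a t) (solY a t) (solX b t) (solY b t))%:R.
have fd1 t : `|fd t| <= 1.
  by rewrite /fd /flag_diff; do 2?case: (0 < _); rewrite ?subrr ?subr0 ?sub0r ?normrN ?normr1 ?normr0.
have st01 t : 0 <= st t <= 1 by rewrite /st; case: steep; rewrite ?lexx ?ler01.
have fs1 t : `|fd t * st t| <= 1.
  have /andP[t0 t1] := st01 t.
  by rewrite normrM -[1]mulr1 ler_pM // ger0_norm.
have l3 e c : `|e| <= 2 -> `|e - l * spin c| <= 3.
  move=> e2; have -> : 3 = 2 + 1 :> R by lra.
  apply: normB_le => //; rewrite normrM gtr0_norm //.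
  by case: c; rewrite ?normrN normr1 mulr1.
(* A far suffix spoils the step into it and the step out of it, at a cost of at most 2 each. The
   subtracted term reserves the second half for the step still to come. *)
suff H : generic a (potential s) -> generic b (potential s) ->
   (count_roots a b s)%:R - fd s * st s <=
   4 * suffix_sum (fun t => (far_at a b t)%:R : R) s - 2 * (far_at a b s)%:R.
  move=> ga gb; have := H ga gb; have := ler_normlW (fs1 s).
  by have : 0 <= (far_at a b s)%:R :> R by []; lra.
elim: s => [|c s IH] ga gb.
  rewrite /count_roots /= rootsC /fd /flag_diff /solY /= !horner0 !mulr0 !ltxx subrr mul0r.
  by rewrite subr0 addr0; have : 0 <= (far_at a b [::])%:R :> R by []; lra.
have ga' : generic a (potential s) by case/andP: ga.
have gb' : generic b (potential s) by case/andP: gb.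
have rf : (count_roots a b (c :: s))%:R = (count_roots a b s)%:R + fd (c :: s).
  rewrite /count_roots (roots_flag ab ga gb) -addrA; congr (_ + _).
have step : fd (c :: s) - fd (c :: s) * st (c :: s) + fd s * st s <=
   2 * (far_at a b (c :: s))%:R + 2 * (far_at a b s)%:R.
  have [f1|nf1] := boolP (far_at a b (c :: s)).
    have /andP[t0 t1] := st01 (c :: s).
    have : fd (c :: s) * (1 - st (c :: s)) <= 1.
      apply: le_trans (ler_norm _) _; rewrite normrM -[leRHS]mulr1 ler_pM //.
      by rewrite ger0_norm; lra.
    have := ler_normlW (fs1 s); have : 0 <= (far_at a b s)%:R :> R by [].
    by rewrite mulrBr mulr1 /=; lra.
  have [f2|nf2] := boolP (far_at a b s).
    have /andP[t0 t1] := st01 (c :: s).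
    have : fd (c :: s) * (1 - st (c :: s)) <= 1.
      apply: le_trans (ler_norm _) _; rewrite normrM -[leRHS]mulr1 ler_pM //.
      by rewrite ger0_norm; lra.
    have := ler_normlW (fs1 s).
    by rewrite mulrBr mulr1 /=; lra.
  rewrite /fd /st !solY_cons (flag_transfer (l3 _ c a2) (l3 _ c b2)).
  - by rewrite mulr0 addr0.
  - exact: solX_cons.
  - exact: solX_cons.
  - exact: generic_neq0.
  - exact: generic_neq0.
  - exact: (generic_neq0 (s := c :: s)).
  - exact: (generic_neq0 (s := c :: s)).
  - exact: nf2.
  - exact: nf1.
have := IH ga' gb'; rewrite rf /=; lra.
Qed.

Section Bounds.
Variables (M E E' sig : R).
Hypotheses (M1 : 1 <= M).
Hypotheses (E0 : E != 0) (E2 : `|E| <= 2) (EM : `|E^-1| <= M).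
Hypotheses (q0 : 0 < sin2 E) (qM : (sin2 E)^-1 <= M).
Hypotheses (E0' : E' != 0) (E2' : `|E'| <= 2) (EM' : `|E'^-1| <= M).
Hypotheses (q0' : 0 < sin2 E') (qM' : (sin2 E')^-1 <= M).
Hypotheses (l0 : 0 < l) (lK : 60 * 10 * 10 * M ^+ 5 * l <= 1 / 2)
  (sE : sig = 60 * 10 * 10 * M ^+ 5 * l).

Definition gap_at (s : seq bool) : R :=
  gap sig l E E' (solX E s) (solY E s) (solX E' s) (solY E' s).

(** Both solutions start from [(1, 0)], so the gap starts at 0, and [B / l ^+ 3] is the fixed point
    of the affine recursion given by [gap_step]. *)
Lemma avg_gap (n : nat) :
  avg n gap_at <= 2 * M * `|E - E'| `^ (1 - sig) / l ^+ 3.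
Proof.
have l3 : 0 < l ^+ 3 by rewrite exprn_gt0.
have [_ l1] := l_small M1 l0 lK.
have /andP[s0 s1] := sig_range M1 l0 lK sE.
set B := 2 * M * `|E - E'| `^ (1 - sig).
have B0 : 0 <= B by rewrite mulr_ge0 ?powR_ge0 // mulr_ge0 // (le_trans _ M1).
elim: n => [|n IH].
  rewrite avg0 /gap_at /gap /solX /solY /= !horner0 !hornerC mulr0 mul0r subrr normr0.
  rewrite powR0 ?mul0r ?divr_ge0 // ?(ltW l3) //; apply/eqP; lra.
rewrite avgS.
apply: (@le_trans _ _ (avg n (fun s => (1 - l ^+ 3) * gap_at s + B))).
  apply: avg_le => s _; rewrite /gap_at !solX_cons !solY_cons /spin mulr1 mulrN1 !opprK.
  apply: (gap_step M1 E0 E2 EM q0 qM E0' E2' EM' q0' qM' l0 lK sE).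
    exact: sol_neq0.
  exact: sol_neq0.
rewrite avgD avgZ avg_cst.
have -> : B / l ^+ 3 = (1 - l ^+ 3) * (B / l ^+ 3) + B by field; rewrite gt_eqF.
rewrite lerD2r; apply: ler_wpM2l => //; rewrite subr_ge0 exprn_ile1 ?(ltW l0) //.
lra.
Qed.

(** The constant 160 is the 4 of [count_roots_le] times the 40 of [far_gap]. *)
Lemma avg_count_roots (n : nat) : E < E' ->
  (forall s, s \in words n -> generic E (potential s)) ->
  (forall s, s \in words n -> generic E' (potential s)) ->
  avg n (fun s => (count_roots E E' s)%:R) <=
  1 + 160 * (n.+1%:R * (2 * M * `|E - E'| `^ (1 - sig) / l ^+ 3)).
Proof.
move=> EE gE gE'; have [_ l1] := l_small M1 l0 lK.
apply: (@le_trans _ _ (avg n (fun s => 1 + 160 * suffix_sum gap_at s))).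
  apply: avg_le => s sn; apply: le_trans (count_roots_le _ _ _ _ (gE s sn) (gE' s sn)) _ => //.
    by apply/andP; split=> //; lra.
  rewrite lerD2l.
  have : suffix_sum (fun t => (far_at E E' t)%:R : R) s <= suffix_sum (fun t => 40 * gap_at t) s.
    apply: suffix_sum_le => t; have [f|_] := boolP (far_at E E' t).
      apply: (far_gap M1 E2 EM q0 qM E2' EM' q0' qM' l0 lK sE) => //.
        exact: sol_neq0.
      exact: sol_neq0.
    by rewrite mulr_ge0 // mulr_ge0 ?powR_ge0 ?sqrtr_ge0.
  have -> : suffix_sum (fun t => 40 * gap_at t) s = 40 * suffix_sum gap_at s.
    by elim: (s) => [|c t IH] /=; rewrite ?IH; ring.
  lra.
rewrite avgD avgZ avg_cst lerD2l ler_pM2l //.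
apply: avg_suffix_sum => k; exact: avg_gap.
Qed.

End Bounds.
End Chain.

(** * Mean eigenvalue counts between two energies *)

Section Count.
Variable R : realType.

(** Genericity for all of [D] only asks to avoid the roots of one nonzero polynomial, the product of
    all the continuants involved; a point just right of [a] will do. *)
Lemma exists_generic (D : seq (seq R)) (a b : R) : a < b ->
  exists2 x, a < x < b & all (generic x) D.
Proof.
move=> ab; suff [p p0 hp] : exists2 p : {poly R}, p != 0 &
    forall x, ~~ root p x -> all (generic x) D.
  have [y] := neighpr_wit ab p0; rewrite /neighpr in_itv /= => /andP[ay yn].
  exists y; last by apply/hp/(@neighpr_root _ p a b); rewrite in_itv /= ay.
  rewrite ay (lt_le_trans yn) //.
  by have := next_root_in p a b; rewrite in_itv /= max_l ?(ltW ab) // => /andP[].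
elim: D => [|d D [p p0 hp]] /=; first by exists 1; rewrite ?oner_neq0.
have [q q0 hq] : exists2 q : {poly R}, q != 0 & forall x, ~~ root q x -> generic x d.
  elim: d => [|c d [q q0 hq]]; first by exists 1; rewrite ?oner_neq0 // => x; rewrite /= root1.
  exists ((jacobi_pair (c :: d)).1 * q); first by rewrite mulf_neq0 // jacobi_neq0.
  by move=> x; rewrite rootM negb_or => /andP[h /hq] /= ->; rewrite andbT.
exists (q * p); first by rewrite mulf_neq0.
by move=> x; rewrite rootM negb_or => /andP[/hq-> /hp->].
Qed.

Variable l : R.

Definition count_eig (E : R) (s : seq bool) : nat :=
  num_eigenvalues_le (dirichlet_restriction
    (anderson_op l (fun m => spin R (nth false s (absz m).-1))) (size s)) E.

Lemma char_poly_word (s : seq bool) :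
  char_poly (dirichlet_restriction
    (anderson_op l (fun m => spin R (nth false s (absz m).-1))) (size s)) =
  (jacobi_pair (potential l s)).1.
Proof.
apply: char_poly_dirichlet; first by rewrite size_map.
by move=> i si; rewrite (nth_map false).
Qed.

Lemma count_eig_mono (E E' : R) (s : seq bool) : E <= E' ->
  (count_eig E s <= count_eig E' s)%N.
Proof. by move=> EE; rewrite /count_eig [leqRHS](num_eigenvaluesD _ EE) leq_addr. Qed.

Lemma count_eig_roots (a b : R) (s : seq bool) : a < b ->
  generic b (potential l s) -> count_eig b s = (count_eig a s + count_roots l a b s)%N.
Proof.
move=> ab gb; apply: num_eigenvalues_roots => //; first exact: char_poly_word.
exact: generic_root.
Qed.

Lemma count_roots_size (a b : R) (s : seq bool) : (count_roots l a b s <= size s)%N.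
Proof.
rewrite /count_roots -ltnS.
have [+ _ _] := jacobi_size (potential l s); rewrite size_map => <-.
apply: max_poly_roots; [exact: jacobi_neq0| |exact: uniq_roots].
by apply/allP => x /root_roots.
Qed.

(** Provides the domination in [ids_increment]; [E'] is moved right to a generic energy so that the
    count becomes a number of roots. *)
Lemma count_eig_diff_size (E E' : R) (s : seq bool) : E <= E' ->
  (count_eig E' s - count_eig E s <= size s)%N.
Proof.
move=> EE; have [b /andP[Eb _] /= /andP[gb _]] :=
  @exists_generic [:: potential l s] E' (E' + 1) ltac:(by rewrite ltrDl).
have Eb' : E < b by exact: le_lt_trans Eb.
apply: (@leq_trans (count_eig b s - count_eig E s)).
  by rewrite leq_sub2r // count_eig_mono // ltW.
by rewrite (count_eig_roots Eb' gb) addKn count_roots_size.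
Qed.

Lemma energy_region (delta E : R) : 0 < delta < 1 -> delta < `|E| < 2 - delta ->
  [/\ E != 0, `|E| <= 2, `|E^-1| <= 2 / delta, 0 < sin2 E & (sin2 E)^-1 <= 2 / delta].
Proof.
move=> /andP[d0 d1] /andP[h1 h2].
have E0 : 0 < `|E| by lra.
(* The factorization [(1 - e / 2) * (1 + e / 2)] with [e] the modulus of [E] gives
   [sin2 E >= 1 - e / 2]. *)
have sq : delta / 2 <= sin2 E.
  rewrite /sin2 -(real_normK (num_real E)); move: (`|E|) h1 h2 E0 => e h1 h2 E0.
  have -> : 1 - e ^+ 2 / 4 = (1 - e / 2) + (1 - e / 2) * (e / 2) by field.
  have : 0 <= (1 - e / 2) * (e / 2) by rewrite mulr_ge0 //; lra.
  by lra.
have d2 : 2 / delta = (delta / 2)^-1 by rewrite invfM invrK mulrC.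
split.
- by rewrite -normr_gt0.
- by lra.
- rewrite normfV d2 lef_pV2 ?posrE //; last by lra.
  by lra.
- by lra.
- by rewrite d2 lef_pV2 ?posrE //; lra.
Qed.

(* [E] and [E'] are moved outwards to energies that are generic for all words,
   whence the factor 3. *)
Lemma avg_count_eig (delta E E' sig : R) (n : nat) : 0 < delta < 1 ->
  let M := 4 / delta in
  0 < l -> 60 * 10 * 10 * M ^+ 5 * l <= 1 / 2 -> sig = 60 * 10 * 10 * M ^+ 5 * l ->
  delta < `|E| < 2 - delta -> delta < `|E'| < 2 - delta -> E < E' ->
  avg n (fun s => (count_eig E' s - count_eig E s)%N%:R) <=
  1 + 160 * (n.+1%:R * (2 * M * (3 * (E' - E)) `^ (1 - sig) / l ^+ 3)).
Proof.
move=> /andP[d0 d1] M l0 lK sE rE rE' EE.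
have M1 : 1 <= M by rewrite /M ler_pdivlMr // mul1r; lra.
have s1 : 0 <= 1 - sig by have /andP[_] := sig_range M1 l0 lK sE; lra.
(* The first bound keeps the new distance below [3 * (E' - E)]; the second keeps both energies in
   the region for [delta / 2], whence [M = 4 / delta]. *)
pose h := Num.min (E' - E) (delta / 2).
have h0 : 0 < h by rewrite /h lt_min subr_gt0 EE divr_gt0.
have h1 : h <= E' - E by rewrite /h ge_min lexx.
have h2 : h <= delta / 2 by rewrite /h ge_min lexx orbT.
pose D := [seq potential l s | s <- words n].
have [a /andP[a0 a1] ga] := @exists_generic D (E - h) E ltac:(by rewrite gtrBl).
have [b /andP[b0 b1] gb] := @exists_generic D E' (E' + h) ltac:(by rewrite ltrDl).
have gen x : all (generic x) D -> forall s, s \in words n -> generic x (potential l s).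
  by move=> /allP gx s sn; apply: gx; apply: map_f.
have ab : a < b by lra.
have ab3 : `|a - b| <= 3 * (E' - E) by rewrite distrC ger0_norm; lra.
have EE3 : 0 <= 3 * (E' - E) by rewrite mulr_ge0 // subr_ge0 ltW.
have near x y : delta < `|y| < 2 - delta -> `|x - y| <= h ->
    delta / 2 < `|x| < 2 - delta / 2.
  move=> /andP[y1 y2] xy; have := lerB_dist y x; have := lerB_dist x y.
  by rewrite [`|y - x|]distrC => k1 k2; apply/andP; split; lra.
have ra : delta / 2 < `|a| < 2 - delta / 2.
  by apply: near rE _; rewrite ler_norml; apply/andP; split; lra.
have rb : delta / 2 < `|b| < 2 - delta / 2.
  by apply: near rE' _; rewrite ler_norml; apply/andP; split; lra.
have dd : 0 < delta / 2 < 1 by apply/andP; split; lra.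
have [nza a2 aM qa qaM] := energy_region dd ra.
have [nzb b2 bM qb qbM] := energy_region dd rb.
have ME : 2 / (delta / 2) = M by rewrite /M; field; rewrite gt_eqF.
rewrite ME in aM qaM bM qbM.
apply: (@le_trans _ _ (avg n (fun s => (count_roots l a b s)%:R))).
  apply: avg_le => s sn; rewrite ler_nat.
  apply: (@leq_trans (count_eig b s - count_eig a s)).
    apply: (@leq_trans (count_eig b s - count_eig E s)).
      by apply: leq_sub2r; apply: count_eig_mono; exact: ltW.
    by apply: leq_sub2l; apply: count_eig_mono; exact: ltW.
  by rewrite (count_eig_roots ab (gen _ gb s sn)) addKn.
apply: le_trans (avg_count_roots M1 nza a2 aM qa qaM nzb b2 bM qb qbM l0 lK sE
  ab (gen _ ga) (gen _ gb)) _.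
rewrite lerD2l ler_pM2l // ler_pM2l ?ltr0n // ler_pM2r ?invr_gt0 ?exprn_gt0 //.
rewrite ler_pM2l; last by rewrite mulr_gt0 // (lt_le_trans _ M1).
by apply: ge0_ler_powR; rewrite ?nnegrE.
Qed.

End Count.

(** * The random operator *)

Lemma mem_words (n : nat) (s : seq bool) : (s \in words n) = (size s == n).
Proof.
apply/idP/eqP; first exact: size_words.
elim: n s => [|n IH] [|b s] //= [sn]; rewrite mem_cat.
by case: b; rewrite ?map_f ?orbT ?IH.
Qed.

Lemma uniq_words (n : nat) : uniq (words n).
Proof.
elim: n => //= n IH; rewrite cat_uniq !map_inj_uniq ?IH ?andbT /=; try by move=> ? ? [].
by apply/hasPn => _ /mapP[t _ ->]; apply/mapP => -[].
Qed.

Section Law.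
Context (R : realType) (d : measure_display) (T : measurableType d)
  (P : probability T R) (eps : int -> {RV P >-> R}).
Hypotheses (ind : mutually_independent eps) (rad : forall m, rademacher (eps m)).

(* The configuration on the sites [1..n], site 1 first. *)
Definition word (n : nat) (w : T) : seq bool :=
  [seq eps (Posz i) w == 1 | i <- iota 1 n].

Lemma size_word (n : nat) (w : T) : size (word n w) = n.
Proof. by rewrite size_map size_iota. Qed.

Definition cyl (n : nat) (s : seq bool) : set T := [set w | word n w = s].

(** The letter [false] stands for every value other than 1, so that the cylinders partition the
    whole space and not merely a set of full measure. *)
Definition spin_event (s : seq bool) (i : int) : set R :=
  if nth false s (absz i).-1 then [set 1] else ~` [set 1].

Lemma measurable_spin_event (s : seq bool) (i : int) : measurable (spin_event s i).
Proof.
by rewrite /spin_event; case: nth; [|apply: measurableC]; exact: measurable_set1.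
Qed.

Lemma prob_spin_event (s : seq bool) (i : int) :
  P (eps i @^-1` spin_event s i) = (2^-1)%:E.
Proof.
have [h1 _] := rad i; rewrite /spin_event; case: nth => //.
rewrite -preimage_setC probability_setC; last exact: measurable_funPTI.
by rewrite [P _]h1 -EFinB; congr EFin; field.
Qed.

Lemma cylE (n : nat) (s : seq bool) : size s = n ->
  cyl n s = \bigcap_(i in [set` map Posz (iota 1 n)]) (eps i @^-1` spin_event s i).
Proof.
move=> sn; apply/seteqP; split=> w.
  move=> <- i /mapP[k]; rewrite mem_iota => /andP[k0 kn] -> /=.
  rewrite /spin_event /word (nth_map 0%N) ?size_iota; last first.
    by case: k k0 kn => // k _; rewrite add1n ltnS.
  rewrite nth_iota; last by case: k k0 kn => // k _; rewrite add1n ltnS.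
  by rewrite add1n prednK //; case: eqP.
move=> h; apply: (@eq_from_nth _ false); first by rewrite size_word sn.
rewrite size_word => i ik; rewrite (nth_map 0%N) ?size_iota // nth_iota // add1n.
have : [set` map Posz (iota 1 n)] i.+1%:Z.
  by apply: map_f; rewrite mem_iota add1n ltnS.
move=> /h; rewrite /spin_event /=; case: nth => /=; first by move=> ->; rewrite eqxx.
by move=> /eqP/negbTE.
Qed.

Lemma measurable_cyl (n : nat) (s : seq bool) : measurable (cyl n s).
Proof.
have [sn|sn] := eqVneq (size s) n.
  rewrite cylE //; apply: fin_bigcap_measurable; first exact: finite_seq.
  by move=> i _; apply: measurable_funPTI; exact: measurable_spin_event.
rewrite (_ : cyl n s = set0) // -subset0 => w /= ws.
by move: sn; rewrite -ws size_word eqxx.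
Qed.

Lemma prob_cyl (n : nat) (s : seq bool) : size s = n -> P (cyl n s) = ((2 ^+ n)^-1)%:E.
Proof.
move=> sn; rewrite cylE // ind; last first.
- by move=> i; exact: measurable_spin_event.
- by rewrite map_inj_uniq ?iota_uniq // => i j [].
rewrite (eq_bigr (fun=> (2^-1)%:E)); last by move=> i _; exact: prob_spin_event.
have prod k m : (\prod_(i <- iota k m) (2^-1 : R)%:E)%E = (2^-1 ^+ m)%:E.
  elim: m k => [|m IH] k /=; first by rewrite big_nil.
  by rewrite big_cons IH -EFinM exprS.
by rewrite big_map prod exprVn.
Qed.

(** Exhibits functions of the word as simple functions, which yields both measurability and the
    integral. *)
Lemma word_decomp (n : nat) (F : seq bool -> R) (w : T) :
  (F (word n w))%:E = (\sum_(s <- words n) (F s)%:E * (\1_(cyl n s) w)%:E)%E.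
Proof.
rewrite (bigD1_seq (word n w)) ?uniq_words ?mem_words ?size_word //=.
rewrite big1 ?adde0 => [|s sw].
  by rewrite indicE mem_set // mule1.
rewrite indicE memNset ?mule0 //= /cyl /= => e.
by rewrite e eqxx in sw.
Qed.

Lemma measurable_cyl_indic (n : nat) (s : seq bool) :
  measurable_fun setT (fun w => (\1_(cyl n s) w : R)%:E).
Proof. by apply/measurable_EFinP; apply: measurable_indic; exact: measurable_cyl. Qed.

Lemma measurable_word (n : nat) (F : seq bool -> R) :
  measurable_fun setT (fun w => (F (word n w))%:E).
Proof.
under eq_fun do rewrite word_decomp.
apply: emeasurable_sum => s; apply: emeasurable_funM; first exact: measurable_cst.
exact: measurable_cyl_indic.
Qed.

Lemma integral_word (n : nat) (F : seq bool -> R) : (forall s, 0 <= F s) ->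
  (\int[P]_w (F (word n w))%:E)%E = (avg n F)%:E.
Proof.
move=> F0; under eq_integral do rewrite word_decomp.
have i0 s w : (0 <= (\1_(cyl n s) w)%:E :> \bar R)%E by rewrite lee_fin.
rewrite ge0_integral_sum //; last 2 first.
- move=> s; apply: emeasurable_funM; first exact: measurable_cst.
  exact: measurable_cyl_indic.
- by move=> s w _; apply: mule_ge0; rewrite ?lee_fin.
rewrite /avg mulr_suml -sumEFin big_seq [RHS]big_seq; apply: eq_bigr => s.
rewrite mem_words => /eqP sn.
rewrite ge0_integralZl_EFin //; last exact: measurable_cyl_indic.
rewrite integral_indic //; last exact: measurable_cyl.
by rewrite setIT [X in (_ * X)%E](prob_cyl sn).
Qed.

End Law.

Section Spins.
Context (R : realType) (d : measure_display) (T : measurableType d)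
  (P : probability T R) (eps : int -> {RV P >-> R}).
Hypotheses (rad : forall m, rademacher (eps m)).

(** The values 1 and -1 together carry all the mass, and countably many null sets are discarded. *)
Lemma ae_spin : {ae P, forall w, forall k : nat,
  eps (Posz k) w = spin R (eps (Posz k) w == 1)}.
Proof.
apply/ae_foralln => k; have [h1 h2] := rad k.
pose A := eps (Posz k) @^-1` [set 1]; pose B := eps (Posz k) @^-1` [set -1].
have mA : measurable A by apply: measurable_funPTI; exact: measurable_set1.
have mB : measurable B by apply: measurable_funPTI; exact: measurable_set1.
exists (~` (A `|` B)); split.
- by apply: measurableC; exact: measurableU.
- apply: etrans (probability_setC P (measurableU A B mA mB)) _.
  have AB : P (A `|` B) = 1%:E.
    rewrite measureU //; last first.
      rewrite -subset0 => w [/= a1]; rewrite /B /= a1 => /eqP; rewrite -subr_eq0 opprK.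
      by rewrite (_ : 1 + 1 = 2%:R) // pnatr_eq0.
    by rewrite [X in (X + _)%E]h1 [X in (_ + X)%E]h2 -EFinD; congr EFin; field.
  by rewrite AB -EFinB subrr.
move=> w; apply: contra_not => -[/= ->|/= ->]; rewrite /spin ?eqxx //.
by rewrite eqNr oner_eq0.
Qed.

Lemma count_eig_word (l : R) (v : int -> R) (E : R) (n : nat) (s : seq bool) :
  size s = n -> (forall i, (i < n)%N -> v i.+1%:Z = spin R (nth false s i)) ->
  num_eigenvalues_le (dirichlet_restriction (anderson_op l v) n) E = count_eig l E s.
Proof.
move=> <- h; rewrite /count_eig.
suff -> : dirichlet_restriction (anderson_op l v) (size s) =
  dirichlet_restriction
    (anderson_op l (fun m => spin R (nth false s (absz m).-1))) (size s) by [].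
by apply/matrixP => i j; rewrite !mxE /anderson_op (h i).
Qed.

End Spins.

(** * Passage to the integrated density of states *)

Section Limit.
Context (R : realType) (d : measure_display) (T : measurableType d)
  (P : probability T R) (eps : int -> {RV P >-> R}).
Hypotheses (ind : mutually_independent eps) (rad : forall m, rademacher (eps m)).

(** Dominated convergence turns the almost sure limit into a limit of means: the normalized count
    lies between 0 and 1. *)
Lemma ids_increment (l : R) (N : R -> R) (E E' : R) : E <= E' -> is_IDS eps l N ->
  (fun n => avg n (fun s => (count_eig l E' s - count_eig l E s)%N%:R / n%:R)) @ \oo
    --> N E' - N E.
Proof.
move=> EE ids.
pose G n s : R := (count_eig l E' s - count_eig l E s)%N%:R / n%:R.
pose f n w := (G n (word eps n w))%:E.
have cvf : {ae P, forall w, setT w -> f ^~ w @ \oo --> (N E' - N E)%:E}.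
  apply: filterS3 (ids E') (ids E) (ae_spin rad) => w h' h sp _.
  have sE n x : num_eigenvalues_le (dirichlet_restriction
      (anderson_op l (fun m => eps m w)) n) x = count_eig l x (word eps n w).
    apply: count_eig_word; first exact: size_word.
    move=> i i_n; rewrite sp; congr spin.
    by rewrite (nth_map 0%N) ?size_iota // nth_iota.
  apply/fine_cvgP; split; first exact: nearW.
  have -> : fine \o f ^~ w =
      (fun n => (num_eigenvalues_le (dirichlet_restriction
        (anderson_op l (fun m => eps m w)) n) E')%:R / n%:R) \-
      (fun n => (num_eigenvalues_le (dirichlet_restriction
        (anderson_op l (fun m => eps m w)) n) E)%:R / n%:R).
    apply: funext => n; rewrite /= !sE /f /G /= natrB ?mulrBl //.
    exact: count_eig_mono.
  exact: cvgB.
have bnd : {ae P, forall w n, setT w -> (`|f n w| <= (EFin \o cst 1%R) w)%E}.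
  apply: aeW => w n _; rewrite /f /= lee_fin /G ger0_norm ?divr_ge0 //.
  (* At [n = 0] the quotient is 0, the inverse of 0 being 0. *)
  case: n => [|n]; first by rewrite invr0 mulr0.
  rewrite ler_pdivrMr // mul1r ler_nat.
  by apply: leq_trans (count_eig_diff_size l _ EE) _; rewrite size_word.
have mf n : measurable_fun setT (f n) by exact: measurable_word.
have mc : measurable_fun setT (fun _ : T => (N E' - N E)%:E) by exact: measurable_cst.
have ig : P.-integrable setT (EFin \o cst 1 : T -> \bar R).
  exact: finite_measure_integrable_cst.
have [_ _] := dominated_convergence measurableT mf mc cvf ig bnd.
rewrite (integral_cst P measurableT) [X in (_ * X)%E](probability_setT P) mule1.
move/fine_cvgP => [_].
suff -> : fine \o (fun n => \int[P]_x f n x)%E = (fun n => avg n (G n)) by [].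
apply: funext => n; rewrite /= integral_word // => s.
by rewrite divr_ge0.
Qed.

Lemma ids_holder (delta l sig : R) (N : R -> R) (E E' : R) : 0 < delta < 1 ->
  let M := 4 / delta in
  0 < l -> 60 * 10 * 10 * M ^+ 5 * l <= 1 / 2 -> sig = 60 * 10 * 10 * M ^+ 5 * l ->
  is_IDS eps l N ->
  delta < `|E| < 2 - delta -> delta < `|E'| < 2 - delta -> E < E' ->
  0 <= N E' - N E <= 320 * (2 * M * (3 * (E' - E)) `^ (1 - sig) / l ^+ 3).
Proof.
move=> dd M l0 lK sE ids rE rE' EE.
have lim := ids_increment (ltW EE) ids.
set B := 2 * M * _ / _.
have B0 : 0 <= B.
  have /andP[d0 _] := dd.
  by rewrite !mulr_ge0 ?powR_ge0 ?invr_ge0 ?exprn_ge0 ?(ltW l0) ?(ltW d0).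
apply/andP; split.
  apply: (ler_cvg_to (@cvg_cst _ (0 : R) _ \oo _) lim); apply: nearW => n /=.
  by rewrite -[leLHS](avg_cst n); apply: avg_le => s _; rewrite divr_ge0.
(* For [n >= 1], [1 / n] is at most [2 * harmonic n = 2 / (n + 1)], and [n + 1 <= 2 * n] doubles 160
   to 320. *)
have lim2 : (fun n => 2 * harmonic n + 320 * B) @ \oo --> 320 * B.
  rewrite -[X in _ --> X]add0r -[X in _ --> X + _](mulr0 2).
  by apply: cvgD; [apply: cvgMr; exact: cvg_harmonic|exact: cvg_cst].
apply: (ler_cvg_to lim lim2); exists 1%N => // n /= n0.
have h := avg_count_eig n dd l0 lK sE rE rE' EE.
have np : 0 < n%:R :> R by rewrite ltr0n.
have -> : avg n (fun s => (count_eig l E' s - count_eig l E s)%N%:R / n%:R) =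
    avg n (fun s => (count_eig l E' s - count_eig l E s)%N%:R) / n%:R :> R.
  by rewrite /avg -mulr_suml mulrAC.
rewrite ler_pdivrMr //; apply: le_trans h _; rewrite -/M -/B.
have n1 : 1 <= n%:R :> R by rewrite ler1n.
rewrite [leRHS]mulrDl; apply: lerD.
  rewrite -mulrA mulrCA mulrC ler_pdivlMr ?ltr0n // -natr1; lra.
have -> : n.+1%:R = n%:R + 1 :> R by rewrite natr1.
have : B <= n%:R * B by rewrite ler_peMl.
lra.
Qed.

End Limit.

(** * Choice of the exponent and of the Hölder constant *)

Theorem theorem2 (R : realType) (delta0 : R) (hdelta0 : 0 < delta0 < 1) :
  exists (lambda0 : R) (s : R -> R),
    [/\ 0 < lambda0,
        forall lambda : R, 0 < lambda < lambda0 -> 0 < s lambda <= 1,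
        s lambda @[lambda --> 0^'+] --> (1 : R) &
        forall lambda : R, 0 < lambda < lambda0 ->
        exists C : R,
        forall (d : measure_display) (T : measurableType d)
          (P : probability T R) (eps : int -> {RV P >-> R}) (N : R -> R),
          mutually_independent eps ->
          (forall m : int, rademacher (eps m)) ->
          is_IDS eps lambda N ->
          forall E E' : R,
            delta0 < `|E| < 2 - delta0 ->
            delta0 < `|E'| < 2 - delta0 ->
            `|N E - N E'| <= C * (`|E - E'| `^ s lambda)].
Proof.
pose K : R := 60 * 10 * 10 * (4 / delta0) ^+ 5.
have K0 : 0 < K.
  have /andP[d0 _] := hdelta0.
  have : 0 < (4 / delta0) ^+ 5 by rewrite exprn_gt0 // divr_gt0.
  by rewrite /K; lra.
have range l : 0 < l < (2 * K)^-1 -> [/\ 0 < l & K * l <= 1 / 2].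
  move=> /andP[l0 l1]; split=> //.
  have KK : 0 < 2 * K by rewrite mulr_gt0.
  have : l * (2 * K) < (2 * K)^-1 * (2 * K) by rewrite ltr_pM2r.
  by rewrite mulVf ?lt0r_neq0 //; lra.
(* The exponent is [1 - sig] with [sig = K * l], and the threshold is where [sig] reaches
   [1 / 2]. *)
exists (2 * K)^-1, (fun l => 1 - K * l); split.
- by rewrite invr_gt0 mulr_gt0.
- move=> l /range[l0 lK]; have : 0 < K * l by rewrite mulr_gt0.
  by move=> ?; apply/andP; split; lra.
- apply: cvg_at_right_filter.
  rewrite -[X in _ --> X]subr0 -[X in _ --> _ - X](mulr0 K).
  by apply: cvgB; [exact: cvg_cst|apply: cvgMr; exact: cvg_id].
move=> l /range[l0 lK].
(* This is the constant of [ids_holder], with the power of 3 split off from the power of the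
   distance. *)
pose C : R := 320 * (2 * (4 / delta0) * 3 `^ (1 - K * l) / l ^+ 3); exists C.
move=> d T P eps N ind rad ids.
have main E E' : delta0 < `|E| < 2 - delta0 -> delta0 < `|E'| < 2 - delta0 ->
    E < E' -> `|N E - N E'| <= C * `|E - E'| `^ (1 - K * l).
  move=> rE rE' EE.
  have /andP[h0 h1] := ids_holder ind rad hdelta0 l0 lK (erefl _) ids rE rE' EE.
  rewrite distrC ger0_norm // distrC [`|E' - E|]ger0_norm ?subr_ge0 ?(ltW EE) //.
  apply: le_trans h1 _; rewrite powRM ?subr_ge0 ?(ltW EE) // /C /K.
  rewrite le_eqVlt; apply/orP; left; apply/eqP.
  by move: (_ `^ _) (_ `^ _) => u v; ring.
move=> E E' rE rE'; have [EE|EE|->] := ltgtP E E'.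
- exact: main.
- by rewrite distrC [`|E - E'|]distrC; exact: main.
- rewrite !subrr normr0 powR0 ?mulr0 //; apply/eqP; lra.
Qed.
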